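(* Let $F$ be any normalized IAP driven random distribution function, with kernel $k$ and background driving process $L_A$ with Poisson intensity measure $\tilde\nu_\alpha$, and let $g$ be any measurable function $g:\mathbb{R}\to\mathbb{R}$. Set $\tilde h(x):=\int_{\mathbb{R}}|g(t)|\,|k'(t,x)|\,dt$, where $k'(t,x):=\frac{\partial}{\partial t}k(t,x)$. Then $\int_{\mathbb{R}}|g(t)|\,dF(t)<+\infty$ almost surely if and only if $$\int_{\mathbb{R}\times(0,+\infty)}[1-\exp(-\lambda v\tilde h(x))]\,\tilde\nu_\alpha(dx\,dv)<+\infty$$ holds for every $\lambda>0$.
   Context: All random objects are defined on a probability space $(\Omega,\mathcal{F},P)$, and ''almost surely'' refers to $P$. An increasing additive process (IAP) is a nondecreasing, right-continuous process with independent increments, started at $0$. Let $\alpha$ be a nondegenerate measure on $\mathscr{B}(\mathbb{R})$ with $\alpha(\mathbb{R})=a\in(0,+\infty)$ and let $A$ be its distribution function. A reparameterized IAP $L_A=\{L_A(x):x\in\mathbb{R}\}$ is obtained from an IAP $L=\{L(y):y\ge0\}$ by the time change $y=A(x)$. It is an almost surely finite IAP uniquely determined by a family of Lévy measures $\{\nu_\alpha(x,dv):x\in\mathbb{R}\}$, its Laplace transform being $E[e^{-\lambda L_A(x)}]=\exp[-\int_0^\infty\{1-e^{-\lambda v}\}\nu_\alpha(x,dv)]$ for any $\lambda\ge0$. Its Poisson intensity measure $\tilde\nu_\alpha$ on $\mathbb{R}\times(0,+\infty)$ is defined by $\tilde\nu_\alpha((-\infty,x]\times C)=\nu_\alpha(x,C)$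 for every $x\in\mathbb{R}$ and $C\in\mathscr{B}((0,+\infty))$. A normalized IAP driven random distribution function is $F(t)=Z(t)/\bar Z$, $t\in\mathbb{R}$, where $Z(t)=\int_{\mathbb{R}}k(t,x)\,dL_A(x)$, $\bar Z=\lim_{t\to+\infty}Z(t)$, and the nonnegative kernel $k$ on $\mathbb{R}\times\mathbb{R}$ and $\tilde\nu_\alpha$ satisfy, with $\bar k(x):=\lim_{t\to+\infty}k(t,x)$: (I) $t\mapsto k(t,x)$ is nondecreasing and right continuous with $\lim_{t\to-\infty}k(t,x)=0$ for every $x\in\mathbb{R}$; (II) $\int_{\mathbb{R}\times(0,+\infty)}[1-\exp\{-\lambda v\bar k(x)\}]\tilde\nu_\alpha(dx\,dv)<+\infty$ for every $\lambda>0$; (III) $\tilde\nu_\alpha(\mathbb{R}\times(0,+\infty))=+\infty$. It is assumed throughout that $F$ admits a density, i.e. that $t\mapsto k(t,x)$ is absolutely continuous for every $x\in\mathbb{R}$; the density is then $f(t)=\int_{\mathbb{R}}k'(t,x)\,dL_A(x)/\bar Z$.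
   Formalization: Since h̃ may be +∞, where the printed equivalence can fail, the criterion also requires h̃(x) < +∞ for ν̃-almost every (x,v); likewise condition (II) is read with k̄ finite ν̃-almost everywhere, so that Z̄ is almost surely finite. *)

(* Defs.v *)
From HB Require Import structures.
From mathcomp Require Import all_boot all_order all_algebra.
From mathcomp Require Import all_classical all_reals all_analysis.

Set Implicit Arguments.
Unset Strict Implicit.
Unset Printing Implicit Defensive.
Import Order.TTheory GRing.Theory Num.Theory.
Import numFieldNormedType.Exports.

Local Open Scope classical_set_scope.
Local Open Scope ring_scope.

(* A fresh head symbol, so that the instance below can depend on the proofs. *)
Definition cumulative_fun (R : realType) (f : R -> R)
  of nondecreasing f & right_continuous f : R -> R := f.

HB.instance Definition _ (R : realType) (f : R -> R)
    (ndf : nondecreasing f) (rcf : right_continuous f) :=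
  isCumulative.Build R _ R (cumulative_fun ndf rcf) ndf rcf.

(* The Lebesgue-Stieltjes measure df of an arbitrary function f. The value mzero
   is a dummy for the f that are not nondecreasing and right-continuous; the
   paths to which it is applied below violate this only on a null event. *)
Definition stieltjes (R : realType) (f : R -> R) :
    {measure set (measurableTypeR R) -> \bar R} :=
  match pselect (nondecreasing f /\ right_continuous f) with
  | left H => lebesgue_stieltjes_measure (cumulative_fun H.1 H.2)
  | right _ => mzero
  end.

Section absolute_continuity.
Context {R : realType}.

Definition absolutely_continuous_on (a b : R) (f : R -> R) : Prop :=
  forall e : R, 0 < e -> exists2 d : R, 0 < d &
    forall (n : nat) (u v : 'I_n -> R),
      (forall i, [/\ a <= u i, u i <= v i & v i <= b]) ->
      trivIset setT (fun i => `]u i, v i[%classic) ->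
      \sum_i (v i - u i) < d -> \sum_i `|f (v i) - f (u i)| < e.

(* On the whole line: absolute continuity on every compact interval. For a
   bounded monotone f this is the same as the epsilon-delta condition on R. *)
Definition absolutely_continuous (f : R -> R) : Prop :=
  forall a b, absolutely_continuous_on a b f.

End absolute_continuity.

Section processes.
Context {R : realType} {d : measure_display} {Om : measurableType d}.
Variable P : probability Om R.

(* Taking some of the B i to be setT gives the product rule for subfamilies. *)
Definition mutually_independent n (X : 'I_n -> Om -> R) : Prop :=
  forall B : 'I_n -> set R, (forall i, measurable (B i)) ->
    P (\bigcap_i (X i @^-1` B i)) = (\prod_i P (X i @^-1` B i))%E.

(* Only the values L y with 0 <= y are meaningful. *)
Record increasing_additive_process (L : R -> Om -> R) : Prop := {
  iap_measurable : forall y : R, 0 <= y -> measurable_fun setT (L y) ;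
  iap_start : {ae P, forall w, L 0 w = 0} ;
  iap_nondecreasing :
    {ae P, forall w, forall y z : R, 0 <= y -> y <= z -> L y w <= L z w} ;
  iap_right_continuous :
    {ae P, forall w, forall y : R, 0 <= y -> L z w @[z --> y^'+] --> L y w} ;
  iap_independent_increments : forall (n : nat) (t : nat -> R),
    0 <= t 0%N -> nondecreasing_seq t ->
    mutually_independent (fun (i : 'I_n) w => L (t i.+1) w - L (t i) w) }.

Definition distribution_function (alpha : {measure set R -> \bar R}) (x : R) : R :=
  fine (alpha `]-oo, x]%classic).

Definition reparameterized (L : R -> Om -> R)
    (alpha : {measure set R -> \bar R}) (x : R) (w : Om) : R :=
  L (distribution_function alpha x) w.

Local Open Scope ereal_scope.

(* Levy measures live on ]0, +oo[; what nu does elsewhere is irrelevant. *)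
Definition levy_measure (nu : {measure set R -> \bar R}) : Prop :=
  \int[nu]_(v in `]0%R, +oo[) (Num.min 1%R v)%:E < +oo.

Definition positive_jumps : set (R * R) := setT `*` `]0%R, +oo[%classic.

(* Where phi = +oo the integrand is 1, for every l > 0. *)
Definition laplace_exponent (nut : {measure set (R * R) -> \bar R})
    (phi : R -> \bar R) (l : R) : \bar R :=
  \int[nut]_(p in positive_jumps) (1 - expeR (- (l * p.2)%:E * phi p.1)).

(* Finiteness of laplace_exponent nut phi l for every l > 0 does not by itself
   give finite_ae nut phi: phi may be +oo on a set B with
   0 < nut (B `*` ]0, +oo[) < +oo, and then the integral of phi against the
   driving process is +oo with positive probability. An integral of
   1 - exp (- l v phi x) is here understood to involve a phi that is real-valued
   nut-almost everywhere, so the two predicates are always used together. *)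
Definition finite_ae (nut : {measure set (R * R) -> \bar R})
    (phi : R -> \bar R) : Prop :=
  {ae nut, forall p, positive_jumps p -> phi p.1 < +oo}.

Definition kbar (k : R -> R -> R) (x : R) : \bar R :=
  lim ((k t x)%:E @[t --> +oo%R]).

Definition Zproc (L : R -> Om -> R) (alpha : {measure set R -> \bar R})
    (k : R -> R -> R) (t : R) (w : Om) : \bar R :=
  \int[stieltjes (reparameterized L alpha ^~ w)]_x (k t x)%:E.

Definition Zbar (L : R -> Om -> R) (alpha : {measure set R -> \bar R})
    (k : R -> R -> R) (w : Om) : \bar R :=
  lim (Zproc L alpha k t w @[t --> +oo%R]).

(* Almost surely both terms are finite; 0 / 0 is 0, so that F vanishes
   identically where Zbar does. *)
Definition normalized_df (L : R -> Om -> R) (alpha : {measure set R -> \bar R})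
    (k : R -> R -> R) (t : R) (w : Om) : R :=
  fine (Zproc L alpha k t w / Zbar L alpha k w).

(* The derivative in t exists for Lebesgue-almost every t when
   k^~ x is absolutely continuous. *)
Definition htilde (g : R -> R) (k : R -> R -> R) (x : R) : \bar R :=
  \int[lebesgue_measure]_t (`|g t| * `|derive1 (k ^~ x) t|)%:E.

Record normalized_IAP (L : R -> Om -> R) (alpha : {measure set R -> \bar R})
    (nu : R -> {measure set R -> \bar R})
    (nut : {measure set (R * R) -> \bar R}) (k : R -> R -> R) : Prop := {
  driving_iap : increasing_additive_process L ;
  alpha_mass : 0 < alpha setT < +oo ;
  (* not concentrated at a point *)
  alpha_nondegenerate : forall c : R, 0 < alpha (~` [set c]) ;
  nu_levy : forall x, levy_measure (nu x) ;
  laplace_transform : forall x l : R, (0 <= l)%R ->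
    'E_P[fun w => expR (- l * reparameterized L alpha x w)%R] =
    expeR (- \int[nu x]_(v in `]0%R, +oo[) (1 - expR (- l * v))%:E) ;
  nut_intensity : forall x (C : set R), measurable C ->
    C `<=` `]0%R, +oo[%classic -> nut (`]-oo, x]%classic `*` C) = nu x C ;
  kernel_ge0 : forall t x, (0 <= k t x)%R ;
  kernel_measurable : forall t, measurable_fun setT (k t) ;
  kernel_nondecreasing : forall x, nondecreasing (k ^~ x) ;
  kernel_right_continuous : forall x, right_continuous (k ^~ x) ;
  kernel_cvg0 : forall x, k t x @[t --> -oo%R] --> (0 : R)%R ;
  kbar_finite : finite_ae nut (kbar k) ;
  kbar_exponent : forall l : R, (0 < l)%R -> laplace_exponent nut (kbar k) l < +oo ;
  nut_infinite : nut positive_jumps = +oo ;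
  kernel_absolutely_continuous : forall x, absolutely_continuous (k ^~ x) }.

End processes.

(* Main.v *)
From HB Require Import structures.
Require Import Defs.
From mathcomp Require Import all_boot all_order all_algebra.
From mathcomp Require Import finmap.
From mathcomp Require Import all_classical all_reals all_analysis.
From mathcomp Require Import measurable_realfun.
Import Order.TTheory GRing.Theory Num.Theory.
Import numFieldNormedType.Exports.
Local Open Scope classical_set_scope.
Local Open Scope ring_scope.
Local Open Scope ereal_scope.

(** Write [mu] for the random Stieltjes measure dL_A, [h] for [htilde g k] and
[Zbar] for the normalizing variable.

The random distribution function is a mixture. Since
Z(t) is the integral of k(t, x) against [mu], the measure dZ is the mixture
under [mu] of the measures dk(., x), and integrating |g| gives

  Zbar * int |g| dF = int (int |g(t)| dk(t, x)) mu(dx).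

Because k(., x) is nondecreasing and absolutely continuous, dk(., x) has the
density k'(., x) ([integral_stieltjes_derive1]), so that the inner integral is
h(x). On the event Zbar < +oo, finiteness of int |g| dF is therefore the same
as finiteness of int h dmu ([integral_normalized_lty]); when Zbar = 0 both
integrals vanish, because 0 / 0 is 0.

It remains to decide when int phi dmu is almost surely finite, for a measurable
phi with values in [0, +oo]. This is read off the Laplace functional
([laplace_functional])

  E exp (- l int phi dmu) = exp (- int (1 - exp (- l v phi(x))) nut(dx dv)).

If the integral is almost surely finite, the left-hand side is positive, so the
exponent is finite; the same formula for the function that is +oo where phi is
+oo and 0 elsewhere shows that phi is finite almost everywhere. Conversely, the
left-hand side is at most the probability that the integral is finite, and the
exponent tends to 0 with l by dominated convergence
([laplace_exponent_ae_lty]). Applied to phi = kbar, this gives Zbar < +oo almost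
surely; applied to phi = h, it gives the theorem.

The Laplace functional is obtained in three stages. For a step function,
int phi dmu is a linear combination of independent increments of L_A, whose
Laplace transforms are quotients of the given ones ([laplace_step]). Both sides
of the formula are continuous under bounded pointwise limits, and every bounded
measurable function is reached from step functions by such limits
([bounded_limit_measurable]); working on a half-line ]-oo, M] keeps [mu] and the
exponents finite. Finally, monotone convergence gives all phi. *)

Set Implicit Arguments.
Unset Strict Implicit.
Unset Printing Implicit Defensive.

(** * Integrals against mixtures of measures *)

Section nonneg_induction.
Context {d} {T : measurableType d} {R : realType}.
Import HBNNSimple.

(** The monotone class argument for nonnegative functions: simple functions are
finite combinations of indicators, and they increase to f. *)
Lemma ge0_measurable_ind (Q : (T -> \bar R) -> Prop) :
  (forall A, measurable A -> Q (fun x => (\1_A x)%:E)) ->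
  (forall (c : R) (f : T -> \bar R), (0 <= c)%R -> measurable_fun setT f ->
    (forall x, 0 <= f x) -> Q f -> Q (fun x => c%:E * f x)) ->
  (forall f g : T -> \bar R, measurable_fun setT f -> (forall x, 0 <= f x) ->
    measurable_fun setT g -> (forall x, 0 <= g x) ->
    Q f -> Q g -> Q (fun x => f x + g x)) ->
  (forall (f_ : nat -> T -> \bar R) (f : T -> \bar R),
    (forall n, measurable_fun setT (f_ n)) ->
    (forall n x, 0 <= f_ n x) -> (forall x, nondecreasing_seq (f_ ^~ x)) ->
    (forall x, f_ n x @[n --> \oo] --> f x) ->
    (forall n, Q (f_ n)) -> Q f) ->
  forall f : T -> \bar R, measurable_fun setT f -> (forall x, 0 <= f x) -> Q f.
Proof.
move=> Qi Qs Qa Ql f mf f0.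
apply: (Ql (fun n x => (nnsfun_approx measurableT mf n x)%:E)).
- by move=> n; exact/measurable_EFinP.
- by move=> n x; rewrite lee_fin.
- by move=> x m n mn; rewrite lee_fin; exact/lefP/nd_nnsfun_approx.
- by move=> x; exact: cvg_nnsfun_approx.
move=> n; set h := nnsfun_approx _ _ _.
have -> : (fun x => (h x)%:E) = (fun x =>
    \sum_(y <- fset_set (range h)) (y * \1_(h @^-1` [set y]) x)%:E).
  apply/funext => x; rewrite {1}fimfunE fsbig_finite//=.
  by rewrite -sumEFin.
have : forall y, y \in enum_fset (fset_set (range h)) -> (0 <= y)%R.
  move=> y; rewrite -[_ \in enum_fset _]/(y \in fset_set _) in_fset_set//.
  by rewrite inE => -[x _ <-].
elim: (enum_fset _) => [_|y s IH sge0].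
  under eq_fun do rewrite big_nil.
  have := Qi set0 measurable0; congr Q; apply/funext => x.
  by rewrite indic0.
under eq_fun do rewrite big_cons.
have y0 : (0 <= y)%R by apply: sge0; exact: mem_head.
have mi z : measurable_fun setT (fun x => (z * \1_(h @^-1` [set z]) x)%:E).
  by apply/measurable_EFinP; apply: measurable_funM => //; exact: measurable_indic.
have i0 z : (0 <= z)%R -> forall x, 0 <= (z * \1_(h @^-1` [set z]) x)%:E.
  by move=> z0 x; rewrite lee_fin mulr_ge0.
apply: Qa => //.
- exact: i0.
- exact: emeasurable_sum.
- move=> x; rewrite big_seq; apply: sume_ge0 => z zs; apply: i0.
  by apply: sge0; apply: mem_behead.
- under eq_fun do rewrite EFinM.
  apply: Qs => //; last exact: Qi.
  by apply/measurable_EFinP; exact: measurable_indic.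
by apply: IH => z zs; apply: sge0; apply: mem_behead.
Qed.

End nonneg_induction.

Lemma cvg_ge0_integral {d} {T : measurableType d} {R : realType}
    (mu : {measure set T -> \bar R}) (f_ : nat -> T -> \bar R) f :
  (forall n, measurable_fun setT (f_ n)) ->
  (forall n x, 0 <= f_ n x) -> (forall x, nondecreasing_seq (f_ ^~ x)) ->
  (forall x, f_ n x @[n --> \oo] --> f x) ->
  \int[mu]_x f_ n x @[n --> \oo] --> \int[mu]_x f x.
Proof.
move=> mf f0 ndf ff.
have -> : f = (fun x => limn (f_ ^~ x)).
  by apply/funext => x; apply/esym/cvg_lim => //; exact: ff.
by apply: cvg_monotone_convergence => // x _; exact: ndf.
Qed.

Lemma cvg_ge0 {R : realType} (u : nat -> \bar R) l :
  (forall n, 0 <= u n) -> u n @[n --> \oo] --> l -> 0 <= l.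
Proof.
move=> u0 ul; rewrite -(cvg_lim _ ul)//; apply: lime_ge.
  by apply/cvg_ex; exists l.
by apply: nearW.
Qed.

Section mixture.
Context {d d'} {Y : measurableType d} {Z : measurableType d'} {R : realType}.

(** Both sides are additive and continuous along increasing sequences as
functions of f, and they agree on indicators. *)
Lemma integral_mixture (mu : {measure set Y -> \bar R})
    (kappa : Y -> {measure set Z -> \bar R}) (nu : {measure set Z -> \bar R}) :
  (forall A, measurable A -> measurable_fun setT (kappa ^~ A)) ->
  (forall A, measurable A -> nu A = \int[mu]_y kappa y A) ->
  forall f : _ -> \bar R, measurable_fun setT f -> (forall z, 0 <= f z) ->
  \int[nu]_z f z = \int[mu]_y \int[kappa y]_z f z.
Proof.
move=> mk nuE.
have mI (f : Z -> \bar R) : measurable_fun setT f -> (forall z, 0 <= f z) ->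
    measurable_fun setT (fun y => \int[kappa y]_z f z).
  by move=> mf f0; exact: measurable_fun_integral_kernel.
have I0 (f : Z -> \bar R) : (forall z, 0 <= f z) ->
    forall y, setT y -> 0 <= \int[kappa y]_z f z.
  by move=> f0 y _; exact: integral_ge0.
apply: ge0_measurable_ind.
- move=> A mA; rewrite integral_indic// setIT nuE//.
  by apply: eq_integral => y _; rewrite integral_indic// setIT.
- move=> c f c0 mf f0 IH.
  have f0' z : setT z -> 0 <= f z by [].
  rewrite (ge0_integralZl_EFin nu measurableT f0' mf c0) IH.
  rewrite -(ge0_integralZl_EFin mu measurableT (I0 f f0) (mI f mf f0) c0).
  apply: eq_integral => y _.
  by rewrite (ge0_integralZl_EFin (kappa y) measurableT f0' mf c0).
- move=> f g mf f0 mg g0 If Ig.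
  have f0' z : setT z -> 0 <= f z by [].
  have g0' z : setT z -> 0 <= g z by [].
  rewrite (ge0_integralD nu measurableT f0' mf g0' mg) If Ig.
  rewrite -(ge0_integralD mu measurableT (I0 f f0) (mI f mf f0) (I0 g g0) (mI g mg g0)).
  apply: eq_integral => y _.
  by rewrite (ge0_integralD (kappa y) measurableT f0' mf g0' mg).
- move=> f_ f mf f0 ndf ff IH.
  have h1 := cvg_ge0_integral (mu := nu) mf f0 ndf ff.
  rewrite -(cvg_lim _ h1)//; apply/cvg_lim => //.
  under eq_fun do rewrite IH.
  apply: cvg_ge0_integral.
  + by move=> n; exact: mI.
  + by move=> n y; exact: integral_ge0.
  + move=> y m n mn; apply: ge0_le_integral => // z _; exact: ndf.
  + by move=> y; exact: cvg_ge0_integral.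
Qed.

End mixture.

Section weighted_image.
Context {d d'} {Y : measurableType d} {Z : measurableType d'} {R : realType}.

(** The mixture of the Dirac masses at X y with weights rho y. Densities and
image measures are both of this form. *)
Lemma integral_weighted_image (mu : {measure set Y -> \bar R})
    (nu : {measure set Z -> \bar R}) (X : Y -> Z) (rho : Y -> R) :
  measurable_fun setT X -> measurable_fun setT rho -> (forall y, 0 <= rho y)%R ->
  (forall A, measurable A -> nu A = \int[mu]_y (rho y * \1_A (X y))%:E) ->
  forall f : Z -> \bar R, measurable_fun setT f -> (forall z, 0 <= f z) ->
  \int[nu]_z f z = \int[mu]_y ((rho y)%:E * f (X y)).
Proof.
move=> mX mrho rho0 nuE f mf f0.
pose kappa y : {measure set Z -> \bar R} := mscale (NngNum (rho0 y)) (\d_(X y)).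
have kE y A : kappa y A = (rho y * \1_A (X y))%:E.
  by rewrite -[LHS]/((rho y)%:E * \d_(X y) A) diracE indicE EFinM.
rewrite (integral_mixture (mu := mu) (kappa := kappa))//.
- apply: eq_integral => y _.
  by rewrite ge0_integral_mscale// integral_dirac// diracT mul1e.
- move=> A mA; under eq_fun do rewrite kE.
  apply/measurable_EFinP; apply: measurable_funM => //.
  by apply: measurableT_comp => //; exact: measurable_indic.
Qed.

End weighted_image.

Lemma integral_density {d} {Y : measurableType d} {R : realType}
    (mu nu : {measure set Y -> \bar R}) (rho : Y -> R) :
  measurable_fun setT rho -> (forall y, 0 <= rho y)%R ->
  (forall A, measurable A -> nu A = \int[mu]_(y in A) (rho y)%:E) ->
  forall f : Y -> \bar R, measurable_fun setT f -> (forall z, 0 <= f z) ->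
  \int[nu]_z f z = \int[mu]_y (f y * (rho y)%:E).
Proof.
move=> mrho rho0 nuE f mf f0; under [RHS]eq_integral do rewrite muleC.
apply: (@integral_weighted_image _ _ _ _ _ mu nu id rho) => // A mA.
rewrite nuE// integral_mkcond; apply: eq_integral => y _.
by rewrite patchE indicE; case: ifP; rewrite ?mulr1 ?mulr0.
Qed.

(** * Stieltjes measures *)

Section stieltjes_facts.
Context {R : realType}.
Implicit Types (f : R -> R) (m : {measure set (measurableTypeR R) -> \bar R}).

Lemma stieltjes_itv_oc f (a b : R) : nondecreasing f -> right_continuous f ->
  (a <= b)%R -> stieltjes f `]a, b]%classic = (f b - f a)%:E.
Proof.
move=> ndf rcf ab; rewrite /stieltjes; case: pselect => [H|]; last by case.
rewrite -[LHS]/(measure_extension (wlength (cumulative_fun H.1 H.2)) _).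
rewrite /measure_extension measurable_mu_extE/=; last exact: is_ocitv.
by rewrite wlength_itv_bnd.
Qed.

(** Half-open intervals form a semiring that generates the Borel sets, and they
have finite measure. *)
Lemma stieltjes_unique f m : nondecreasing f -> right_continuous f ->
  (forall a b : R, (a < b)%R -> m `]a, b]%classic = (f b - f a)%:E) ->
  forall A, measurable A -> stieltjes f A = m A.
Proof.
move=> ndf rcf mE A mA.
have E a b : (a < b)%R -> stieltjes f `]a, b]%classic = (f b - f a)%:E.
  by move=> ab; apply: stieltjes_itv_oc => //; exact: ltW.
move: E; rewrite /stieltjes; case: pselect => [H|]; last by case.
move=> E; apply: lebesgue_stieltjes_measure_unique => // X.
move=> /ocitvP[->|[[a b]/= ab ->]]; first by rewrite !measure0.
by rewrite E// mE.
Qed.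

(** An exhaustion of the line by intervals that have finite Stieltjes measure
and belong to the semiring that generates the Borel sets. *)
Definition sym_itv (n : nat) : set R := `](- (n%:R))%R, (n%:R)%R]%classic.

Lemma measurable_sym_itv n : measurable (sym_itv n).
Proof. exact: measurable_itv. Qed.
Hint Resolve measurable_sym_itv : core.

Lemma sym_itv_cover : \bigcup_n sym_itv n = [set: R].
Proof.
apply/seteqP; split => // x _; exists (Num.trunc `|x|).+1 => //=.
have h : (`|x| < (Num.trunc `|x|).+1%:R)%R by exact: truncnS_gt.
by rewrite /sym_itv/= in_itv/=; move: h; rewrite ltr_norml => /andP[-> /ltW ->].
Qed.

Lemma subset_sym_itv i j : (i <= j)%N -> sym_itv i `<=` sym_itv j.
Proof.
move=> mn x; rewrite /sym_itv/= !in_itv/= => /andP[h1 h2].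
rewrite (le_trans h2) ?ler_nat// andbT.
by apply: le_lt_trans h1; rewrite lerN2 ler_nat.
Qed.

Lemma cvg_measure_sym_itv m A : measurable A ->
  m (A `&` sym_itv n) @[n --> \oo] --> m A.
Proof.
move=> mA.
have -> : m A = m (\bigcup_n (A `&` sym_itv n)).
  by rewrite -setI_bigcupr sym_itv_cover setIT.
apply: nondecreasing_cvg_mu.
- by move=> n; apply: measurableI => //; exact: measurable_sym_itv.
- by apply: bigcup_measurable => n _; apply: measurableI => //; exact: measurable_sym_itv.
- by move=> i j ij; apply/subsetPset; apply: setIS; exact: subset_sym_itv.
Qed.

(** On half-open intervals the measure is a difference of values of f w, hence
measurable in w; a Dynkin argument inside each [sym_itv n], where all measures
are finite, extends this to Borel sets. *)
Lemma measurable_stieltjes d (T : measurableType d) (f : T -> R -> R) :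
  (forall w, nondecreasing (f w)) -> (forall w, right_continuous (f w)) ->
  (forall x, measurable_fun setT (f ^~ x)) ->
  forall A : set R, measurable A -> measurable_fun setT (fun w => stieltjes (f w) A).
Proof.
move=> ndf rcf mf A mA.
have mD := measurable_sym_itv.
have DE n w : stieltjes (f w) (sym_itv n) = (f w n%:R%R - f w (- n%:R)%R)%:E.
  by rewrite stieltjes_itv_oc// -subr_ge0 opprK addr_ge0.
have mh (a b : R) : measurable_fun setT (fun w => (f w a - f w b)%:E).
  by apply/measurable_EFinP; exact: measurable_funB.
suff h n : measurable_fun setT (fun w => stieltjes (f w) (A `&` sym_itv n)).
  apply: (emeasurable_fun_cvg (fun n w => stieltjes (f w) (A `&` sym_itv n))) => //.
  by move=> w _; exact: cvg_measure_sym_itv.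
apply: (@dynkin_induction _ (measurableTypeR R) (@ocitv R)
  (fun B => measurable_fun setT (fun w => stieltjes (f w) (B `&` sym_itv n)))) => //.
- exact: ocitvI.
- apply: (eq_measurable_fun (fun w => (f w n%:R%R - f w (- n%:R)%R)%:E)) => //.
  by move=> w _; rewrite setTI DE.
- move=> B oB; have := ocitvI oB (is_ocitv (- n%:R)%R n%:R%R).
  move=> /ocitvP[|[[a b]/= ab]]; rewrite /sym_itv => ->.
    apply: (eq_measurable_fun (cst 0)) => // w _.
    by rewrite measure0.
  apply: (eq_measurable_fun (fun w => (f w b - f w a)%:E)) => // w _.
  by rewrite (stieltjes_itv_oc (ndf _) (rcf _) (ltW ab)).
- move=> B mB IH.
  have -> : (fun w => stieltjes (f w) (~` B `&` sym_itv n)) = (fun w =>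
      (f w n%:R%R - f w (- n%:R)%R)%:E - stieltjes (f w) (B `&` sym_itv n)).
    apply/funext => w; rewrite -DE -[in RHS](setIC (sym_itv n)) setIC -setDE.
    apply: measureD => //; first exact: mD.
    have h : stieltjes (f w) (sym_itv n) < +oo by rewrite DE ltry.
    exact: h.
  exact: emeasurable_funB.
- move=> F mF tF IH.
  have -> : (fun w => stieltjes (f w) (\bigcup_k F k `&` sym_itv n)) = (fun w =>
      \sum_(0 <= k <oo) stieltjes (f w) (F k `&` sym_itv n)).
    apply/funext => w; rewrite setI_bigcupl.
    have mFD k : measurable (F k `&` sym_itv n).
      by apply: measurableI; [exact: mF|exact: mD].
    rewrite measure_bigcup//; last exact: trivIset_setIr.
    by apply: eq_eseriesl => k; rewrite in_setT.
  by apply: ge0_emeasurable_sum.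
Qed.

End stieltjes_facts.

(** * Absolutely continuous monotone functions *)

Section integral_ae_eq_ge0.
Import HBNNSimple.

(** Neither function is assumed to be measurable: the integral of a nonnegative
function is a supremum over the simple functions below it, and these can be cut
off on a null set. The derivative of a monotone function is only known almost
everywhere, which is why this form is needed. *)
Lemma integral_ae_eq_ge0 {d} {T : measurableType d} {R : realType}
    (mu : {measure set T -> \bar R}) (f h : T -> \bar R) :
  (forall x, 0 <= f x) -> (forall x, 0 <= h x) ->
  {ae mu, forall x, f x = h x} -> \int[mu]_x f x = \int[mu]_x h x.
Proof.
suff le (f1 f2 : T -> \bar R) : (forall x, 0 <= f1 x) -> (forall x, 0 <= f2 x) ->
    {ae mu, forall x, f1 x = f2 x} -> \int[mu]_x f1 x <= \int[mu]_x f2 x.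
  move=> f0 h0 fh; apply/eqP; rewrite eq_le !le//.
  by apply: filterS fh => x ->.
move=> f0 h0 [N [mN N0 fhN]]; rewrite !ge0_integralTE//.
apply: ge_ereal_sup => _ [g /= gf <-].
pose g' := proj_nnsfun g (measurableC mN).
have -> : sintegral mu g = sintegral mu g'.
  rewrite -!integralT_nnsfun; apply: ge0_ae_eq_integral => //.
  - by apply/measurable_EFinP.
  - by apply/measurable_EFinP.
  - by move=> x _; rewrite lee_fin.
  - by move=> x _; rewrite lee_fin.
  - exists N; split => // x /=; apply: contra_notP => Nx _.
    by rewrite mindicE mem_set//= mulr1.
apply: ereal_sup_ubound; exists g' => //= x.
rewrite mindicE; case: (boolP (x \in _)) => [|_]; last by rewrite mulr0.
rewrite inE mulr1 => Nx.
have -> : f2 x = f1 x by apply: contra_notP Nx => fh; apply: fhN => /= /esym.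
exact: gf.
Qed.

End integral_ae_eq_ge0.

Section absolutely_continuous_stieltjes.
Context {R : realType}.
Variable f : R -> R.
Hypotheses (ndf : nondecreasing f) (rcf : right_continuous f)
  (acf : absolutely_continuous f).
Let leb : measure _ _ := @lebesgue_measure R.

Lemma stieltjes_itv_oo_le (a b : R) : (a <= b)%R ->
  stieltjes f `]a, b[%classic <= (f b - f a)%:E.
Proof.
move=> ab; rewrite -stieltjes_itv_oc//.
apply: le_measure; rewrite ?inE; try exact: measurable_itv.
by move=> x /=; rewrite !in_itv/= => /andP[-> /ltW].
Qed.

(** This also covers the empty set, for which inf and sup are both 0. *)
Lemma open_interval_bounded (I : set R) (c : R) : (0 <= c)%R ->
  open I -> is_interval I -> I `<=` `](-c)%R, c[%classic ->
  [/\ (-c <= inf I)%R, (inf I <= sup I)%R, (sup I <= c)%R &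
      I = `](inf I), (sup I)[%classic].
Proof.
move=> c0 oI iI Ic.
have [->|/set0P I0] := eqVneq I set0.
  rewrite inf_out ?sup_out; last 2 first.
  - by move=> [[]].
  - by move=> [[]].
  by split; rewrite ?oppr_le0// set_itvoo0.
have lI : lbound I (-c)%R.
  by move=> x /Ic/=; rewrite in_itv/= => /andP[/ltW].
have uI : ubound I c by move=> x /Ic/=; rewrite in_itv/= => /andP[_ /ltW].
split.
- exact: lb_le_inf.
- have [x Ix] := I0; apply: (@le_trans _ _ x).
    by apply: ge_inf => //; exists (-c)%R.
  by apply: ub_le_sup => //; exists c.
- exact: ge_sup.
- have := interval_bounded_interior iI (ex_intro _ _ lI) (ex_intro _ _ uI).
  by rewrite (interior_id I).1.
Qed.

(** A bounded null set is covered by an open set of small length. Its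
components are disjoint intervals, so absolute continuity bounds the sum of the
oscillations of f over finitely many of them, that is, their Stieltjes
measure. *)
Lemma stieltjes_dominated : stieltjes f `<< leb.
Proof.
apply/null_content_dominatesP => A mA A0.
suff h n : stieltjes f (A `&` sym_itv n) = 0.
  have := cvg_measure_sym_itv (m := stieltjes f) mA.
  under eq_fun do rewrite h.
  by move=> /(cvg_lim (@ereal_hausdorff R)) <-; rewrite lim_cst.
set A' := A `&` _; have mA' : measurable A'.
  by apply: measurableI => //; exact: measurable_sym_itv.
pose c : R := n.+1%:R.
have c0 : (0 <= c)%R by rewrite /c.
have A'c : A' `<=` `](-c)%R, c[%classic.
  move=> x [_]; rewrite /sym_itv/= !in_itv/= => /andP[h1 h2]; apply/andP; split.
    by apply: lt_trans h1; rewrite ltrN2 ltr_nat.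
  by apply: (le_lt_trans h2); rewrite ltr_nat.
have lebA' : leb A' = 0.
  by apply: (@subset_measure0 _ _ _ leb A' A) => //; exact: subIsetl.
apply/eqP; rewrite eq_le measure_ge0 andbT.
apply/lee_addgt0Pr => e e0; rewrite add0e.
(* The modulus delta bounds the length of the open cover V below. *)
have [delta delta0 H] := @acf (-c)%R c e e0.
have lebA'y : leb A' < +oo by rewrite lebA' ltry.
have [U [oU A'U Ud]] := lebesgue_regularity_outer mA' lebA'y delta0.
pose V := U `&` `](-c)%R, c[%classic.
have oV : open V by apply: openI => //; exact: interval_open.
have A'V : A' `<=` V by move=> x A'x; split; [exact: A'U|exact: A'c].
have mV : measurable V by exact: open_measurable.
have Vd : leb V < delta%:E.
  have mU : measurable U by exact: open_measurable.
  have UE : leb U <= leb (U `\` A').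
    have -> : leb U = leb (U `\` A') + leb (U `&` A') by exact: measureDI.
    rewrite [X in _ + X](_ : _ = 0) ?adde0//.
    by apply: (@subset_measure0 _ _ _ leb _ A') => //; exact: measurableI.
  apply: le_lt_trans (le_lt_trans UE Ud).
  by apply: le_measure; rewrite ?inE; [exact: mV|exact: mU|exact: subIsetl].
pose I := open_disjoint_itv oV.
have Iq q : [/\ (-c <= inf (I q))%R, (inf (I q) <= sup (I q))%R, (sup (I q) <= c)%R &
      I q = `](inf (I q)), (sup (I q))[%classic].
  apply: open_interval_bounded => //.
  - exact: open_disjoint_itv_open.
  - exact: open_disjoint_itv_is_interval.
  - move=> x Ix; suff : V x by case.
    by rewrite (open_disjoint_itv_bigcup oV); exists q.
have tI : trivIset setT I by exact: open_disjoint_itv_trivIset.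
have VI : V = \bigcup_q I q by exact: open_disjoint_itv_bigcup.
have mI q : measurable (I q) by have [_ _ _ ->] := Iq q; exact: measurable_itv.
apply: (@le_trans _ _ (stieltjes f V)).
  by apply: le_measure; rewrite ?inE; [exact: mA'|exact: mV|exact: A'V].
rewrite VI measure_bigcup//; last by move=> q _; exact: mI.
apply: lime_le; first by apply: is_cvg_nneseries.
apply: nearW => m; rewrite big_mkord.
apply: (@le_trans _ _ (\sum_(q < m) (f (sup (I q)) - f (inf (I q)))%:E)).
  rewrite big_mkcond/=; apply: lee_sum => q _; rewrite in_setT.
  by have [_ le _ IE] := Iq q; rewrite {1}IE; exact: stieltjes_itv_oo_le.
rewrite sumEFin lee_fin; apply: ltW.
apply: le_lt_trans (H m (fun i => inf (I i)) (fun i => sup (I i)) _ _ _).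
- by apply: ler_sum => i _; exact: ler_norm.
- by move=> i; have [] := Iq i.
- apply/trivIsetP => i j _ _ ij.
  have [_ _ _ <-] := Iq i; have [_ _ _ <-] := Iq j.
  by move/trivIsetP : tI; apply.
- rewrite -lte_fin; apply: le_lt_trans Vd.
  rewrite -sumEFin.
  have -> : \sum_(i < m) (sup (I i) - inf (I i))%:E = \sum_(i < m) leb (I i).
    apply: eq_bigr => i _; have [_ le _ IE] := Iq i; rewrite [in RHS]IE.
    apply/esym; apply: (etrans (lebesgue_measure_itv `](inf (I i)), (sup (I i))[%R)).
    rewrite /= lte_fin; case: ltP => // le'.
    by congr (_%:E); apply/esym/eqP; rewrite subr_eq0 eq_le le' le.
  have -> : leb V = \sum_(0 <= q <oo) leb (I q).
    rewrite VI measure_bigcup//; last by move=> q _; exact: mI.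
    by apply: eq_eseriesl => q; rewrite in_setT.
  rewrite -(big_mkord xpredT (fun i => leb (I i))).
  exact: nneseries_lim_ge.
Qed.

Let right_slope (x : R) (m : nat) : R := (m.+1%:R * (f (m.+1%:R^-1 + x) - f x))%R.

Lemma cvg_right_slope (x l : R) : derivable f x 1 -> derive1 f x = l ->
  right_slope x m @[m --> \oo] --> l.
Proof.
move=> dfx fxl.
have /cvg_dnbhs_at_right/cvg_at_rightP H :
    (h^-1 *: (f (h + x) - f x))%R @[h --> (0 : R)%R^'] --> l.
  rewrite -fxl /derive1; move: dfx; rewrite /derivable.
  rewrite [X in cvg (X @ _)](_ : _ = (fun h => h^-1 *: (f (h + x) - f x))%R) //.
  by apply/funext => h /=; rewrite [(h *: 1)%R]mulr1.
have hu : (forall m : nat, 0 < m.+1%:R^-1 :> R)%R /\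
    (m.+1%:R^-1 : R)%R @[m --> \oo] --> (0 : R)%R.
  by split; [move=> m; rewrite invr_gt0|exact: cvg_harmonic].
have := H (fun m => m.+1%:R^-1)%R hu.
by under eq_fun do rewrite invrK.
Qed.

(** The density comes from the Radon-Nikodym theorem on a bounded interval,
where the Stieltjes measure is finite; there f is a primitive of it up to a
constant, and the Lebesgue differentiation theorem identifies it with the
derivative. *)
Lemma ae_derivable_density n : exists rho : R -> R,
  [/\ measurable_fun setT rho, forall x, (0 <= rho x)%R,
    forall A, measurable A ->
      stieltjes f (A `&` sym_itv n) = \int[leb]_(x in A) (rho x)%:E &
    {ae leb, forall x, (- n%:R < x < n%:R)%R ->
      derivable f x 1 /\ derive1 f x = rho x}].
Proof.
have mD : @measurable _ (measurableTypeR R) (sym_itv n) by exact: measurable_sym_itv.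
have Dy : stieltjes f (sym_itv n) < +oo.
  by rewrite stieltjes_itv_oc ?ltry// -subr_ge0 opprK addr_ge0.
pose nu := mfrestr mD Dy.
have nuleb : nu `<< leb.
  apply/null_content_dominatesP => A mA A0.
  have /null_content_dominatesP H := stieltjes_dominated.
  have := H A mA A0; rewrite /nu /mfrestr /mrestr => SA.
  by apply: subset_measure0 SA => //; exact: measurableI.
have [rho [rho0 rhof rhoi nuE]] := radon_nikodym_sigma_finite nuleb.
pose r := fine \o rho.
have rE x : (r x)%:E = rho x by rewrite /r/= fineK.
have ri : leb.-integrable setT (EFin \o r).
  by apply: eq_integrable rhoi => // x _; rewrite /= rE.
exists r; split.
- by apply/measurable_EFinP; exact: measurable_int ri.
- by move=> x; rewrite /r/= fine_ge0.
- move=> A mA; apply: (etrans (nuE A mA)).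
  by apply: eq_integral => x _; rewrite rE.
have riy y : leb.-integrable `]-oo, y] (EFin \o r).
  by apply: integrableS ri => //; exact: measurable_itv.
have rl : locally_integrable [set: R] r.
  by apply: open_integrable_locally ri; exact: openT.
have := FTC1Ny riy rl.
apply: filterS; first exact: (ae_filter_ringOfSetsType leb).
move=> x + /andP[nx xn].
set F := (F in derivable F) => -[dF F'].
have FE y : (- n%:R < y < n%:R)%R -> F y = (f y - f (- n%:R))%R.
  move=> /andP[ny yn]; rewrite /F /Rintegral.
  rewrite [X in fine X](_ : _ = nu `]-oo, y]%classic).
    rewrite /nu /mfrestr /mrestr.
    rewrite (_ : _ `&` _ = `](- n%:R)%R, y]%classic); last first.
      apply/seteqP; split => z; rewrite /sym_itv/= !in_itv/=.
        by move=> [-> /andP[->]].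
      by move=> /andP[-> zy]; rewrite zy (le_trans zy (ltW yn)).
    by rewrite stieltjes_itv_oc//; exact: ltW.
  have mI : @measurable _ (measurableTypeR R) `]-oo, y]%classic by exact: measurable_itv.
  by apply/esym; apply: (etrans (nuE _ mI)); apply: eq_integral => z _; rewrite rE.
have fF : {near x, (F + cst (f (- n%:R)))%R =1 f}.
  have : \forall y \near x, y \in `](- n%:R)%R, n%:R%R[.
    by apply: near_in_itvoo; rewrite in_itv/= nx.
  apply: filterS => y; rewrite in_itv/= => yn.
  by rewrite -[LHS]/(F y + f (- n%:R))%R FE// subrK.
have dFc : derivable (F + cst (f (- n%:R)))%R x 1.
  exact: (derivableD dF (derivable_cst _ _ _)).
split; first exact: near_eq_derivable fF dFc.
rewrite derive1E -(near_eq_derive _ fF) (deriveD dF (derivable_cst _ _ _)).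
by rewrite derive_cst addr0 -derive1E.
Qed.

(** The densities obtained on bounded intervals are all versions of the
derivative, which glues them together. As the derivative need not be
measurable, it is replaced by the limit superior of the right difference
quotients. *)
Lemma integral_stieltjes_derive1 (g : R -> R) : measurable_fun setT g ->
  (forall t, 0 <= g t)%R ->
  \int[leb]_t (g t * `|derive1 f t|)%:E = \int[stieltjes f]_t (g t)%:E.
Proof.
move=> mg g0.
have mf : measurable_fun setT f.
  by apply: nondecreasing_measurable => // x y; exact: ndf.
(* A measurable function that agrees with the derivative where it
   exists. *)
pose h x := limn_esup (fun m => (right_slope x m)%:E).
pose r x := `|fine (h x)|%R.
have mr : measurable_fun setT r.
  apply: measurableT_comp => //; apply: measurableT_comp => //.
  apply: measurable_fun_limn_esup => m; apply/measurable_EFinP.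
  apply: measurable_funM => //; apply: measurable_funB => //.
  apply: measurableT_comp => //; exact: measurable_funD.
have [rho /all_and4[mrho rho0 rhoE aerho]] := choice ae_derivable_density.
have aeall : {ae leb, forall x n, (- n%:R < x < n%:R)%R ->
      derivable f x 1 /\ derive1 f x = rho n x}.
  have := ae_foralln aerho; apply: filterS => x H n; exact: H.
have hE x n : derivable f x 1 -> derive1 f x = rho n x -> r x = rho n x.
  move=> dfx fx; rewrite /r /h.
  have /cvg_limn_einf_sup[_ ->] : (right_slope x m)%:E @[m --> \oo] --> (rho n x)%:E.
    by apply: cvg_EFin; [exact: nearW|exact: cvg_right_slope].
  by rewrite /= ger0_norm.
have stE A : measurable A -> stieltjes f A = \int[leb]_(x in A) (r x)%:E.
  move=> mA.
  have hn n : stieltjes f (A `&` sym_itv n) = \int[leb]_(x in A `&` sym_itv n) (r x)%:E.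
    have mAn : @measurable _ (measurableTypeR R) (A `&` sym_itv n).
      by apply: measurableI => //; exact: measurable_sym_itv.
    (* The density is known inside sym_itv n.+1, which contains the
       endpoints of sym_itv n. *)
    have e : A `&` sym_itv n = (A `&` sym_itv n) `&` sym_itv n.+1.
      by apply/esym/setIidl => x [_]; apply: subset_sym_itv; exact: leqnSn.
    rewrite {1}e rhoE//; apply: ge0_ae_eq_integral => //.
    + by apply/measurable_EFinP; apply: measurable_funTS; exact: mrho.
    + by apply/measurable_EFinP; apply: measurable_funTS; exact: mr.
    + by move=> x _; rewrite lee_fin.
    + by move=> x _; rewrite lee_fin /r normr_ge0.
    + move: aeall; apply: filterS; first exact: (ae_filter_ringOfSetsType leb).
      move=> x xP [_]; rewrite /sym_itv/= in_itv/= => /andP[h1 h2].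
      have [|dfx fx] := xP n.+1.
        apply/andP; split; last by rewrite (le_lt_trans h2)// ltr_nat.
        by apply: lt_trans h1; rewrite ltrN2 ltr_nat.
      by rewrite (hE x n.+1).
  have c1 := cvg_measure_sym_itv (m := stieltjes f) mA.
  rewrite -(cvg_lim _ c1)//; apply/cvg_lim => //.
  under eq_fun do rewrite hn.
  rewrite [X in \int[_]_(x in X) _](_ : _ = \bigcup_n (A `&` sym_itv n)); last first.
    by rewrite -setI_bigcupr sym_itv_cover setIT.
  apply: ge0_nondecreasing_set_cvg_integral => //.
  - by move=> i j ij; apply/subsetPset; apply: setIS; exact: subset_sym_itv.
  - by move=> i; apply: measurableI => //; exact: measurable_sym_itv.
  - by move=> i; apply/measurable_EFinP; apply: measurable_funTS; exact: mr.
  - by move=> i x _; rewrite lee_fin /r normr_ge0.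
have r0 y : (0 <= r y)%R by rewrite /r normr_ge0.
have mge : measurable_fun setT (EFin \o g) by apply/measurable_EFinP.
have ge0 t : 0 <= (EFin \o g) t by rewrite lee_fin.
apply/esym.
apply: (etrans (@integral_density _ (measurableTypeR R) R leb (stieltjes f) r
  mr r0 stE (EFin \o g) mge ge0)).
apply/esym.
apply: integral_ae_eq_ge0 => [t|t|].
- by rewrite lee_fin mulr_ge0.
- by rewrite mule_ge0// lee_fin.
move: aeall; apply: filterS; first exact: (ae_filter_ringOfSetsType leb).
move=> x xP; have [n _ xn] : (\bigcup_n @sym_itv R n) x by rewrite sym_itv_cover.
have [|dfx fx] := xP n.+1.
  move: xn; rewrite /sym_itv/= in_itv/= => /andP[h1 h2].
  apply/andP; split; last by rewrite (le_lt_trans h2)// ltr_nat.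
  by apply: lt_trans h1; rewrite ltrN2 ltr_nat.
by rewrite (hE x n.+1)// fx ger0_norm.
Qed.

End absolutely_continuous_stieltjes.

(** * Independence and expectations of products *)

Section independence.
Context {R : realType} {d : measure_display} {Om : measurableType d}.
Variable P : probability Om R.

(** The hypothesis says that the measure with density Y with respect to P and
the measure c P have the same image under X; both sides are integrals of f
against this image. *)
Lemma product_rule_ge0 (X Y : Om -> R) (c : R) :
  measurable_fun setT X -> measurable_fun setT Y ->
  (0 <= c)%R -> (forall w, 0 <= Y w)%R ->
  (forall B, measurable B ->
    \int[P]_w (Y w * \1_B (X w))%:E = c%:E * P (X @^-1` B)) ->
  forall f : R -> \bar R, measurable_fun setT f -> (forall x, 0 <= f x) ->
  \int[P]_w ((Y w)%:E * f (X w)) = c%:E * \int[P]_w f (X w).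
Proof.
move=> mX mY c0 Y0 H f mf f0.
pose nu : {measure set R -> \bar R} := mscale (NngNum c0) (pushforward P X).
rewrite -(integral_weighted_image (nu := nu mX) mX mY Y0)//; last first.
  by move=> B mB; rewrite H.
rewrite ge0_integral_mscale//; congr (_ * _).
by rewrite (ge0_integral_pushforward mX)// preimage_setT.
Qed.

Lemma integral_unit_fin (Y : Om -> R) : measurable_fun setT Y ->
  (forall w, 0 <= Y w <= 1)%R -> \int[P]_w (Y w)%:E \is a fin_num.
Proof.
move=> mY Y01; rewrite ge0_fin_numE; last first.
  by apply: integral_ge0 => w _; rewrite lee_fin; case/andP: (Y01 w).
apply: (@le_lt_trans _ _ (\int[P]_w (cst 1%E) w)).
  apply: ge0_le_integral => //.
  - by move=> w _; rewrite lee_fin; case/andP: (Y01 w).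
  - exact/measurable_EFinP.
  - by move=> w _; rewrite lee_fin; case/andP: (Y01 w).
rewrite integral_cst// mul1e.
by apply: (le_lt_trans (probability_le1 P measurableT)); rewrite ltry.
Qed.

(** Independence is a statement about indicators. The factors are replaced one
after the other by bounded functions; at each stage [product_rule_ge0] applies
with the product of the remaining factors as the weight. *)
Lemma expectation_prod_independent n (X : 'I_n -> Om -> R) (f : 'I_n -> R -> R) :
  (forall i, measurable_fun setT (X i)) -> mutually_independent P X ->
  (forall i, measurable_fun setT (f i)) -> (forall i x, 0 <= f i x <= 1)%R ->
  \int[P]_w (\prod_i f i (X i w))%:E = (\prod_i fine (\int[P]_w (f i (X i w))%:E))%:E.
Proof.
move=> mX indX.
have mfX (h : 'I_n -> R -> R) i : (forall i, measurable_fun setT (h i)) ->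
    measurable_fun setT (fun w => h i (X i w)).
  by move=> mf; exact: measurableT_comp.
(* Induction on the number k of factors that are no longer
   indicators. *)
suff H k : forall f : 'I_n -> R -> R, (forall i, measurable_fun setT (f i)) ->
    (forall i x, 0 <= f i x <= 1)%R ->
    (forall i : 'I_n, (k <= i)%N -> exists2 B, measurable B & f i = \1_B) ->
    \int[P]_w (\prod_i f i (X i w))%:E = (\prod_i fine (\int[P]_w (f i (X i w))%:E))%:E.
  by move=> mf f01; apply: (H n) => // i; rewrite leqNgt ltn_ord.
elim: k => [|k IH] {}f mf f01 fB.
  have {fB} /choice[B fB] : forall i, exists B, measurable B /\ f i = \1_B.
    by move=> i; have [B mB fiB] := fB i isT; exists B.
  have mXB i : measurable (X i @^-1` B i).
    by rewrite -[X in measurable X]setTI; apply: mX => //; case: (fB i).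
  have fXE i w : f i (X i w) = \1_(X i @^-1` B i) w by case: (fB i) => _ ->.
  under [in RHS]eq_bigr => i _.
    under eq_integral do rewrite fXE.
    rewrite integral_indic// setIT.
    over.
  have -> : (\prod_i fine (P (X i @^-1` B i)))%:E = \prod_i P (X i @^-1` B i).
    rewrite -prodEFin; apply: eq_bigr => i _.
    by rewrite fineK// fin_num_measure.
  rewrite -indX; last by move=> i; case: (fB i).
  rewrite -[in RHS](setIT (\bigcap_i _)) -integral_indic//; last first.
    by apply: fin_bigcap_measurable.
  apply: eq_integral => w _; congr (_%:E).
  under eq_bigr do rewrite fXE.
  rewrite [RHS]indicE; case: (boolP (w \in _)) => [|/negP].
    by rewrite inE => wB; apply: big1 => i _; rewrite indicE mem_set//; exact: wB.
  rewrite inE => /existsNP[i /not_implyP[_ wB]].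
  by rewrite (bigD1 i)//= indicE memNset// mul0r.
have [nk|kn] := leqP n k.
  by apply: IH => // i ki; have := ltn_ord i; rewrite ltnNge (leq_trans nk ki).
pose j := Ordinal kn.
(* The factor of index k is the one that stops being an indicator. *)
pose Y w := (\prod_(i | i != j) f i (X i w))%R.
have mY : measurable_fun setT Y.
  rewrite /Y; under eq_fun do rewrite big_mkcond/=.
  by apply: measurable_prod => i _; case: (i != j) => //; exact: mfX.
have Y01 w : (0 <= Y w <= 1)%R.
  apply/andP; split; first by apply: prodr_ge0 => i _; case/andP: (f01 i (X i w)).
  by apply: prodr_ile1 => i _.
pose c := (\prod_(i | i != j) fine (\int[P]_w (f i (X i w))%:E))%R.
have fin i : \int[P]_w (f i (X i w))%:E \is a fin_num.
  by apply: integral_unit_fin => //; exact: mfX.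
have c0 : (0 <= c)%R.
  apply: prodr_ge0 => i _; apply/fine_ge0/integral_ge0 => w _.
  by rewrite lee_fin; case/andP: (f01 i (X i w)).
rewrite [in RHS](bigD1 j)//= -/c [in RHS]mulrC EFinM fineK//.
rewrite -(@product_rule_ge0 _ _ _ (mX j) mY _ _ _ (EFin \o f j)).
- by apply: eq_integral => w _; rewrite (bigD1 j)//= -/(Y w) mulrC.
- exact: c0.
- by move=> w; case/andP: (Y01 w).
- move=> B mB.
  pose f' i := if i == j then \1_B else f i.
  have mf' i : measurable_fun setT (f' i).
    by rewrite /f'; case: ifP => // _; exact: measurable_indic.
  have f'01 i x : (0 <= f' i x <= 1)%R.
    rewrite /f'; case: ifP => // _; rewrite indicE.
    by case: (_ \in _); rewrite ?lexx ?ler01.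
  have f'B (i : 'I_n) : (k <= i)%N -> exists2 B, measurable B & f' i = \1_B.
    rewrite /f' => ki; case: eqP => [_|/eqP ij]; first by exists B.
    by apply: fB; rewrite ltn_neqAle ki andbT eq_sym.
  have f'j : f' j = \1_B by rewrite /f' eqxx.
  have f'i i : i != j -> f' i = f i by rewrite /f' => /negbTE ->.
  have mXB : measurable (X j @^-1` B).
    by rewrite -[X in measurable X]setTI; exact: mX.
  have := IH f' mf' f'01 f'B; rewrite (bigD1 j)//= f'j.
  under [X in (_ * X)%R]eq_bigr => i ij do rewrite (f'i i ij).
  rewrite -/c mulrC EFinM fineK; last first.
    by apply: integral_unit_fin => [|w]; [exact: measurableT_comp|rewrite -f'j].
  have -> : \int[P]_w (\1_B (X j w))%:E = P (X j @^-1` B).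
    by rewrite -[in RHS](setIT (X j @^-1` B)) -integral_indic.
  move=> <-; apply: eq_integral => w _; rewrite (bigD1 j)//= f'j mulrC.
  by congr (_ * _)%:E; apply: eq_bigr => i ij; rewrite f'i.
- exact/measurable_EFinP.
- by move=> x; rewrite lee_fin; case/andP: (f01 j x).
Qed.

End independence.

(** * Laplace transforms of step functions *)

Section cells.
Context {R : realType}.

Definition cell (t : nat -> R) (i : nat) : set R :=
  if i is j.+1 then `]t j, t i]%classic else `]-oo, t 0%N]%classic.

Lemma measurable_cell t i : measurable (cell t i).
Proof. by case: i => [|i]; exact: measurable_itv. Qed.

Lemma set_itvNyc_cell (t : nat -> R) n : nondecreasing_seq t ->
  `]-oo, t n.+1]%classic = `]-oo, t n]%classic `|` cell t n.+1.
Proof.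
move=> ndt; apply/seteqP; split => x /=; rewrite !in_itv/=.
  by move=> xt; have [h|h] := leP x (t n); [left|right].
by move=> [xt|/andP[]//]; apply: (le_trans xt); exact: ndt.
Qed.

Lemma integral_cells d (T : measurableType d) (m : {measure set T -> \bar R})
    (E : set R -> set T) (t : nat -> R) (h : T -> \bar R) n :
  nondecreasing_seq t -> (forall A, measurable A -> measurable (E A)) ->
  (forall A B, E (A `|` B) = E A `|` E B) ->
  (forall A B, A `&` B = set0 -> E A `&` E B = set0) ->
  measurable_fun setT h -> (forall A x, E A x -> 0 <= h x) ->
  \int[m]_(x in E `]-oo, t n]%classic) h x =
  \sum_(i < n.+1) \int[m]_(x in E (cell t i)) h x.
Proof.
move=> ndt mE EU EI mh h0; elim: n => [|n IH]; first by rewrite big_ord1.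
rewrite big_ord_recr/= -IH set_itvNyc_cell// EU ge0_integral_setU//.
- by apply: mE; exact: measurable_itv.
- by apply: mE; exact: measurable_cell.
- exact: measurable_funTS.
- by move=> x [|]; exact: h0.
- apply/disj_set2P; apply: EI; apply/seteqP; split => x //= [].
  by rewrite !in_itv/= => h1 /andP[]; rewrite ltNge h1.
Qed.

End cells.

Section random_measure.
Context {R : realType} {d : measure_display} {Om : measurableType d}.
Variables (P : probability Om R) (G : Om -> R -> R)
  (nut : {measure set (R * R) -> \bar R}).

(** The mass of the i-th cell; the first one starts at -oo, where the paths
vanish. *)
Definition increment (t : nat -> R) (i : nat) (w : Om) : R :=
  (G w (t i) - if i is j.+1 then G w (t j) else 0)%R.

Definition jumps_in (D : set R) : set (R * R) := D `*` `]0%R, +oo[%classic.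

(** What the Laplace functional depends on. The paths are regular for every w,
not only almost surely, so that their Stieltjes measures are always the
expected ones. *)
Record poisson_path : Prop := {
  path_nd : forall w, nondecreasing (G w) ;
  path_rc : forall w, right_continuous (G w) ;
  path_cvg0 : forall w, G w x @[x --> -oo%R] --> (0 : R)%R ;
  path_measurable : forall x, measurable_fun setT (G ^~ x) ;
  path_independent : forall n t, nondecreasing_seq t ->
    mutually_independent P (fun i : 'I_n => increment t i) ;
  path_exponent_fin : forall (x c : R), (0 <= c)%R ->
    \int[nut]_(p in jumps_in `]-oo, x]%classic) (1 - expR (- (c * p.2)))%:E < +oo ;
  path_laplace : forall (x c : R), (0 <= c)%R ->
    \int[P]_w (expR (- (c * G w x)))%:E =
    expeR (- \int[nut]_(p in jumps_in `]-oo, x]%classic) (1 - expR (- (c * p.2)))%:E) }.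

Hypothesis HG : poisson_path.

Lemma stieltjes_Nyc w x : stieltjes (G w) `]-oo, x]%classic = (G w x)%:E.
Proof.
have h : stieltjes (G w) `](- (n%:R : R))%R, x]%classic @[n --> \oo] -->
    stieltjes (G w) `]-oo, x]%classic.
  have -> : `]-oo, x]%classic = \bigcup_n `](- (n%:R : R))%R, x]%classic.
    by rewrite itvNybndEbigcup.
  apply: nondecreasing_cvg_mu.
  - by move=> n; exact: measurable_itv.
  - by apply: bigcup_measurable => n _; exact: measurable_itv.
  - move=> m n mn; apply/subsetPset => y /=; rewrite !in_itv/= => /andP[h ->].
    by rewrite andbT; apply: le_lt_trans h; rewrite lerN2 ler_nat.
rewrite -(cvg_lim _ h)//; apply/cvg_lim => //.
have : (G w x - G w (- (n%:R : R))%R)%:E @[n --> \oo] --> (G w x - 0)%R%:E.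
  apply: cvg_EFin; first exact: nearW.
  apply: cvgB; first exact: cvg_cst.
  have H := path_cvg0 HG w; apply: cvg_comp H.
  apply/cvgNry; rewrite (_ : (- _)%R = (fun n : nat => n%:R : R)%R).
    exact: cvgr_idn.
  by apply/funext => n; exact: opprK.
rewrite subr0; apply: cvg_trans; apply: near_eq_cvg.
near=> n; rewrite stieltjes_itv_oc//.
- exact: path_nd HG w.
- exact: path_rc HG w.
- by rewrite lerNl; near: n; exact: nbhs_infty_ger.
Unshelve. all: by end_near. Qed.

Lemma path_ge0 w x : (0 <= G w x)%R.
Proof. by rewrite -lee_fin -stieltjes_Nyc. Qed.

Lemma increment_ge0 t i w : nondecreasing_seq t -> (0 <= increment t i w)%R.
Proof.
case: i => [|i] ndt; first by rewrite /increment subr0 path_ge0.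
by rewrite subr_ge0; apply: path_nd HG _ _ _ _; exact: ndt.
Qed.

Lemma measurable_increment t i : measurable_fun setT (increment t i).
Proof.
apply: measurable_funB; first exact: path_measurable HG _.
by case: i => // i; exact: path_measurable HG _.
Qed.

Lemma sum_increment t n w : (\sum_(i < n.+1) increment t i w = G w (t n))%R.
Proof.
elim: n => [|n IH]; first by rewrite big_ord1 /increment subr0.
by rewrite big_ord_recr/= IH /increment addrC subrK.
Qed.

Lemma stieltjes_cell t i w : nondecreasing_seq t ->
  stieltjes (G w) (cell t i) = (increment t i w)%:E.
Proof.
case: i => [|i] ndt; first by rewrite /cell stieltjes_Nyc /increment subr0.
rewrite stieltjes_itv_oc//; last exact: ndt.
- exact: path_nd HG w.
- exact: path_rc HG w.
Qed.

Lemma expectation_prod_increments n t (c : 'I_n -> R) : nondecreasing_seq t ->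
  (forall i, 0 <= c i)%R ->
  \int[P]_w (\prod_i expR (- (c i * increment t i w)))%:E =
  (\prod_i fine (\int[P]_w (expR (- (c i * increment t i w)))%:E))%:E.
Proof.
move=> ndt c0.
pose f (i : 'I_n) (x : R) := expR (- (c i * Num.max 0 x))%R.
have mf i : measurable_fun setT (f i).
  apply: measurableT_comp => //; apply: measurableT_comp => //.
  apply: measurable_funM => //; exact: measurable_maxr.
have f01 i x : (0 <= f i x <= 1)%R.
  by rewrite expR_ge0/= -expR0 ler_expR oppr_le0 mulr_ge0// le_max lexx.
have fE (i : 'I_n) w : expR (- (c i * increment t i w))%R = f i (increment t i w).
  by rewrite /f max_r// increment_ge0.
under eq_integral do under eq_bigr do rewrite fE.
under [in RHS]eq_bigr do under eq_integral do rewrite fE.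
apply: expectation_prod_independent => //.
- by move=> i; exact: measurable_increment.
- exact: path_independent HG _ _ ndt.
Qed.

Definition cell_exponent t i (c : R) :=
  \int[nut]_(p in jumps_in (cell t i)) (1 - expR (- (c * p.2)))%:E.

Lemma measurable_jumps_in A : measurable A -> measurable (jumps_in A).
Proof. by move=> mA; apply: measurableX => //; exact: measurable_itv. Qed.

Lemma jumps_inU A B : jumps_in (A `|` B) = jumps_in A `|` jumps_in B.
Proof.
apply/seteqP; split => -[x v] /=; case=> -[].
- by left.
- by right.
- by split => //; left.
- by split => //; right.
Qed.

Lemma jumps_inI0 A B : A `&` B = set0 -> jumps_in A `&` jumps_in B = set0.
Proof.
move=> AB; apply/seteqP; split => // -[x v] [[/= Ax _] [/= Bx _]].
by have : (A `&` B) x by []; rewrite AB.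
Qed.

Lemma one_sub_expR_ge0 (c : R) A p : (0 <= c)%R -> jumps_in A p ->
  0 <= (1 - expR (- (c * p.2)))%:E.
Proof.
move=> c0 [_]; rewrite /= in_itv/= andbT => /ltW p0.
by rewrite lee_fin subr_ge0 -expR0 ler_expR oppr_le0 mulr_ge0.
Qed.

Lemma measurable_one_sub_expR (f : R -> R) : measurable_fun setT f ->
  measurable_fun setT (fun p : R * R => (1 - expR (- (f p.1 * p.2)))%:E).
Proof.
move=> mf; apply/measurable_EFinP; apply: measurable_funB => //.
apply: measurableT_comp => //; apply: measurableT_comp => //.
by apply: measurable_funM => //; exact: measurableT_comp.
Qed.

Lemma cell_exponent_fin t i (c : R) : (0 <= c)%R -> nondecreasing_seq t ->
  cell_exponent t i c \is a fin_num.
Proof.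
move=> c0 ndt; rewrite ge0_fin_numE; last first.
  by apply: integral_ge0 => p; exact: one_sub_expR_ge0.
apply: le_lt_trans (path_exponent_fin HG (t i) c0).
apply: ge0_subset_integral.
- by apply: measurable_jumps_in; exact: measurable_cell.
- by apply: measurable_jumps_in; exact: measurable_itv.
- by apply: measurable_funTS; exact: measurable_one_sub_expR.
- by move=> p; exact: one_sub_expR_ge0.
- move=> [x v] [/= xc v0]; split => //=; move: xc.
  by case: i => [|i]//; rewrite /cell/= !in_itv/= => /andP[].
Qed.

Lemma exponent_cells t n (f : R -> R) : nondecreasing_seq t ->
  measurable_fun setT f -> (forall x, 0 <= f x)%R ->
  (forall i x, (i <= n)%N -> cell t i x -> f x = f (t i)) ->
  \int[nut]_(p in jumps_in `]-oo, t n]%classic) (1 - expR (- (f p.1 * p.2)))%:E =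
  (\sum_(i < n.+1) fine (cell_exponent t i (f (t i))))%:E.
Proof.
move=> ndt mf f0 fcell; rewrite (@integral_cells _ _ _ nut jumps_in)//.
- rewrite -sumEFin; apply: eq_bigr => i _.
  rewrite (fineK (cell_exponent_fin i (f0 (t i)) ndt)).
  apply: eq_integral => -[x v]; rewrite inE => -[/= xc _].
  by rewrite (fcell i)// -ltnS.
- exact: measurable_jumps_in.
- exact: jumps_inU.
- exact: jumps_inI0.
- exact: measurable_one_sub_expR.
- by move=> A [x v]; exact: one_sub_expR_ge0.
Qed.

(** Up to any index, the product of the transforms of the increments is the
transform of the value of the path, by independence; consecutive products
determine the factors. *)
Lemma laplace_increment t i (c : R) : nondecreasing_seq t -> (0 <= c)%R ->
  fine (\int[P]_w (expR (- (c * increment t i w)))%:E) =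
  expR (- fine (cell_exponent t i c)).
Proof.
move=> ndt c0.
pose a j := fine (\int[P]_w (expR (- (c * increment t j w)))%:E).
pose b j := fine (cell_exponent t j c).
have ab n : (\prod_(j < n.+1) a j = \prod_(j < n.+1) expR (- b j))%R.
  apply: EFin_inj; rewrite -expR_sum sumrN.
  rewrite -(expectation_prod_increments (c := fun=> c))//.
  under eq_integral => w _.
    rewrite -expR_sum sumrN -mulr_sumr sum_increment.
    over.
  rewrite /= path_laplace// -[RHS]/(expeR (- (\sum_(j < n.+1) b j)%:E)).
  congr (expeR (- _)).
  exact: (exponent_cells (f := cst c)).
rewrite -/(a i) -/(b i); case: i => [|i].
  by have := ab 0%N; rewrite !big_ord1.
have := ab i.+1; rewrite !(big_ord_recr i.+1)/= ab => /mulfI; apply.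
by apply/prodf_neq0 => j _; rewrite gt_eqF ?expR_gt0.
Qed.

Lemma laplace_step t n (f : R -> R) : nondecreasing_seq t ->
  measurable_fun setT f -> (forall x, 0 <= f x)%R ->
  (forall i x, (i <= n)%N -> cell t i x -> f x = f (t i)) ->
  \int[P]_w expeR (- \int[stieltjes (G w)]_(x in `]-oo, t n]%classic) (f x)%:E) =
  expeR (- \int[nut]_(p in jumps_in `]-oo, t n]%classic)
             (1 - expR (- (f p.1 * p.2)))%:E).
Proof.
move=> ndt mf f0 fcell; rewrite (exponent_cells ndt mf f0 fcell)/=.
rewrite -sumrN expR_sum.
under [in RHS]eq_bigr do rewrite -laplace_increment//.
rewrite -(expectation_prod_increments (c := fun i => f (t i)))//.
apply: eq_integral => w _.
rewrite (@integral_cells _ _ (measurableTypeR R) (stieltjes (G w)) id)//.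
- rewrite -expR_sum sumrN.
  rewrite -[RHS]/(expeR (- (\sum_(i < n.+1) f (t i) * increment t i w)%R%:E)).
  rewrite -sumEFin; congr (expeR (- _)).
  apply: eq_bigr => i _.
  rewrite (eq_integral (cst (f (t i))%:E)); last first.
    by move=> x /[!inE] xc /=; rewrite (fcell i)// -ltnS.
  rewrite integral_cst ?stieltjes_cell//; exact: measurable_cell.
- exact/measurable_EFinP.
- by move=> A x _; rewrite lee_fin.
Qed.

End random_measure.

(** * Bounded pointwise limits of step functions *)

Section bounded_limits.
Context {R : realType}.
Implicit Types (f g : R -> R) (S : (R -> R) -> Prop).

(** An inductive predicate, because it is used through its induction principle:
a property of functions that is stable under limits of uniformly bounded
sequences has to be checked on S only. *)
Inductive bounded_limit S : (R -> R) -> Prop :=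
| bounded_limit_base f : S f -> bounded_limit S f
| bounded_limit_lim (f_ : nat -> R -> R) f (C : R) :
    (forall n, bounded_limit S (f_ n)) -> (forall n x, `|f_ n x| <= C)%R ->
    (forall x, f_ n x @[n --> \oo] --> f x) -> bounded_limit S f.

(** A function is constant on the cells cut by finitely many points exactly
when it depends on x only through the comparisons of x with these points. In
this form stability under pointwise operations is immediate. *)
Definition step_fun f : Prop :=
  [/\ measurable_fun setT f, exists C : R, forall x, (`|f x| <= C)%R &
    exists s : seq R, forall x y : R,
      (forall t, t \in s -> (x <= t)%R = (y <= t)%R) -> f x = f y].

Lemma step_funD f g : step_fun f -> step_fun g -> step_fun (f \+ g)%R.
Proof.
move=> [mf [C fC] [s fs]] [mg [D gD] [t gt]]; split.
- exact: measurable_funD.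
- by exists (C + D)%R => x; apply: (le_trans (ler_normD _ _)); exact: lerD.
- exists (s ++ t) => x y H /=; congr (_ + _)%R.
    by apply: fs => z zs; apply: H; rewrite mem_cat zs.
  by apply: gt => z zs; apply: H; rewrite mem_cat zs orbT.
Qed.

Lemma step_funZ (a : R) f : step_fun f -> step_fun (fun x => a * f x)%R.
Proof.
move=> [mf [C fC] [s fs]]; split.
- exact: measurable_funM.
- by exists (`|a| * C)%R => x; rewrite normrM; exact: ler_wpM2l.
- by exists s => x y /fs ->.
Qed.

Lemma step_fun_bounded_limit f : bounded_limit step_fun f ->
  exists C : R, forall x, (`|f x| <= C)%R.
Proof.
elim => {f}[f [] //|f_ f C _ _ fC ff].
exists C => x; have h : `|f_ n x|%R @[n --> \oo] --> `|f x|%R.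
  by apply: cvg_norm; exact: ff.
rewrite -(cvg_lim _ h)//; apply: limr_le; first by apply/cvg_ex; exists `|f x|%R.
by apply: nearW.
Qed.

(** First one argument is kept in the class of step functions while the other
one varies, then the roles are exchanged. *)
Lemma bounded_limitD f g : bounded_limit step_fun f -> bounded_limit step_fun g ->
  bounded_limit step_fun (f \+ g)%R.
Proof.
move=> bf; elim: bf g => {f}[f sf|f_ f C bf IH fC ff] g bg.
  elim: bg => {g}[g sg|g_ g D bg IH gD gg].
    by apply: bounded_limit_base; exact: step_funD.
  have [_ [C fC] _] := sf.
  apply: (@bounded_limit_lim _ (fun n => f \+ g_ n)%R _ (C + D)%R) => //.
  - by move=> n x; apply: (le_trans (ler_normD _ _)); exact: lerD.
  - by move=> x; apply: cvgD => //; exact: cvg_cst.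
have [D gD] := step_fun_bounded_limit bg.
apply: (@bounded_limit_lim _ (fun n => f_ n \+ g)%R _ (C + D)%R) => //.
- by move=> n; exact: IH.
- by move=> n x; apply: (le_trans (ler_normD _ _)); exact: lerD.
- by move=> x; apply: cvgD => //; exact: cvg_cst.
Qed.

Lemma bounded_limitZ (a : R) f : bounded_limit step_fun f ->
  bounded_limit step_fun (fun x => a * f x)%R.
Proof.
elim => {f}[f sf|f_ f C bf IH fC ff].
  by apply: bounded_limit_base; exact: step_funZ.
apply: (@bounded_limit_lim _ (fun n x => a * f_ n x)%R _ (`|a| * C)%R) => //.
- by move=> n x; rewrite normrM; exact: ler_wpM2l.
- by move=> x; apply: cvgM => //; exact: cvg_cst.
Qed.

Lemma bounded_limit_cst (a : R) : bounded_limit step_fun (cst a).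
Proof.
apply: bounded_limit_base; split => //; first by exists `|a|%R.
by exists [::].
Qed.

Lemma bounded_limit_sum (s : seq R) (F : R -> R -> R) :
  (forall i, i \in s -> bounded_limit step_fun (F i)) ->
  bounded_limit step_fun (fun x => \sum_(i <- s) F i x)%R.
Proof.
elim: s => [_|i s IH sF].
  by under eq_fun do rewrite big_nil; exact: bounded_limit_cst.
under eq_fun do rewrite big_cons; apply: bounded_limitD.
  by apply: sF; exact: mem_head.
by apply: IH => j js; apply: sF; rewrite inE js orbT.
Qed.

(** Half-open intervals have step functions as indicators. As the class is
closed under sums and bounded limits, the sets whose indicator belongs to it
form a Dynkin system. *)
Lemma bounded_limit_indic (A : set R) : measurable A ->
  bounded_limit step_fun (\1_A : R -> R).
Proof.
move=> mA.
apply: (@dynkin_induction _ (measurableTypeR R) (@ocitv R)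
  (fun B => bounded_limit step_fun (\1_B : R -> R))) => //.
- exact: ocitvI.
- by rewrite indicT; exact: bounded_limit_cst.
- move=> B /ocitvP[->|[[a b]/= ab ->]]; first by rewrite indic0; exact: bounded_limit_cst.
  apply: bounded_limit_base; split.
  + by apply: measurable_indic; exact: measurable_itv.
  + by exists 1%R => x; rewrite indicE; case: (_ \in _); rewrite ?normr1 ?normr0.
  + exists [:: a; b] => x y H; rewrite !indicE !mem_setE/= !in_itv/=.
    by rewrite !ltNge !H ?mem_head// inE mem_head orbT.
- move=> B mB bB.
  have -> : (\1_(~` B) : R -> R) = (cst 1 \+ (fun x => - 1 * \1_B x))%R.
    apply/funext => x; rewrite /= !indicE in_setC.
    by case: (x \in B); rewrite ?mulr1 ?mulr0 ?subrr ?addr0.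
  by apply: bounded_limitD; [exact: bounded_limit_cst|exact: bounded_limitZ].
- move=> F mF tF bF.
  pose U n := \big[setU/set0]_(k < n) F k.
  have bU n : bounded_limit step_fun (\1_(U n) : R -> R).
    rewrite /U; elim: n => [|n IH].
      by rewrite big_ord0 indic0; exact: bounded_limit_cst.
    rewrite big_ord_recr/=.
    have -> : (\1_(\big[setU/set0]_(i < n) F i `|` F n) : R -> R) =
        (\1_(\big[setU/set0]_(i < n) F i) \+ \1_(F n))%R.
      apply/funext => x; rewrite /= !indicE in_setU.
      case: (boolP (x \in F n)) => [xF|_]; last by rewrite orbF addr0.
      suff -> : (x \in \big[setU/set0]_(i < n) F i) = false by rewrite /= add0r.
      apply/negbTE/negP; rewrite inE -bigcup_mkord => -[k/= kn Fk].
      move/trivIsetP : tF => /(_ k n Logic.I Logic.I).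
      rewrite ltn_eqF// => /(_ isT) FF.
      suff : (F k `&` F n) x by rewrite FF.
      by split => //; rewrite inE in xF.
    by apply: bounded_limitD; [exact: IH|exact: bF].
  apply: (@bounded_limit_lim _ (fun n => \1_(U n)) _ 1%R) => //.
    by move=> n x; rewrite indicE; case: (_ \in _); rewrite ?normr1 ?normr0.
  move=> x; apply: cvg_near_cst.
  have [[k _ Fkx]|nF] := pselect ((\bigcup_k F k) x).
    exists k.+1 => // n /= kn.
    have UF : U n x by rewrite /U -bigcup_mkord; exists k.
    by rewrite !indicE (mem_set UF) mem_set//; exists k.
  apply: nearW => n.
  have nU : ~ U n x by rewrite /U -bigcup_mkord => -[k _ Fk]; apply: nF; exists k.
  by rewrite !indicE (memNset nU) memNset.
Qed.

Import HBNNSimple.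

(** Simple functions increase to f and remain below its bound. *)
Lemma bounded_limit_measurable f (C : R) : measurable_fun setT f ->
  (forall x, 0 <= f x <= C)%R -> bounded_limit step_fun f.
Proof.
move=> mf fC; have mef : measurable_fun setT (EFin \o f) by exact/measurable_EFinP.
have f0 x : 0 <= (EFin \o f) x by rewrite lee_fin; case/andP: (fC x).
pose f_ := nnsfun_approx measurableT mef.
have ff x : f_ n x @[n --> \oo] --> f x.
  have h : (f_ n x)%:E @[n --> \oo] --> (f x)%:E by exact: cvg_nnsfun_approx.
  by have /fine_cvgP[_] := h.
have f_le n x : (f_ n x <= f x)%R.
  rewrite -(cvg_lim _ (ff x))//; apply: nondecreasing_cvgn_le.
    by move=> i j ij; exact/lefP/nd_nnsfun_approx.
  by apply/cvg_ex; exists (f x).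
apply: (@bounded_limit_lim _ (fun n => f_ n) _ C) => //; last first.
  move=> n x; rewrite ger0_norm//; apply: (le_trans (f_le n x)).
  by case/andP: (fC x).
move=> n; rewrite (_ : (f_ n : R -> R) = (fun x =>
    \sum_(y <- enum_fset (fset_set (range (f_ n)))) y * \1_(f_ n @^-1` [set y]) x)%R).
  apply: bounded_limit_sum => y _; apply: bounded_limitZ.
  by apply: bounded_limit_indic.
by apply/funext => x; rewrite {1}fimfunE fsbig_finite.
Qed.

End bounded_limits.

(** * The Laplace functional of the driving measure *)

Section exponential.
Context {R : realType}.

Lemma expeRN_le1 (x : \bar R) : 0 <= x -> 0 <= expeR (- x) <= 1.
Proof. by move=> x0; rewrite expeR_ge0 -expeR0 lee_expeR leeNl oppe0. Qed.

(** Continuity of exp (- x) on [0, +oo], including the value 0 at +oo. *)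
Lemma cvg_expeRN (u : nat -> \bar R) (l : \bar R) : (forall n, 0 <= u n) ->
  u n @[n --> \oo] --> l -> expeR (- u n) @[n --> \oo] --> expeR (- l).
Proof.
move=> u0 ul; have l0 := cvg_ge0 u0 ul; case: l l0 ul => [r| |]//.
  move=> r0 /fine_cvgP[ufin ur].
  have h : (expR (- fine (u n)))%:E @[n --> \oo] --> (expR (- r))%:E.
    apply: cvg_EFin; first exact: nearW.
    apply: continuous_cvg; first exact: continuous_expR.
    by apply: cvgN; exact: ur.
  apply: cvg_trans h; apply: near_eq_cvg.
  by apply: filterS ufin => n un; rewrite -[in RHS](fineK un).
move=> _ uy.
have v01 n : 0 <= expeR (- u n) <= 1 by exact: expeRN_le1.
have vfin n : expeR (- u n) \is a fin_num.
  apply: fin_real; case/andP: (v01 n) => v0 v1.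
  by rewrite (lt_le_trans _ v0)// (le_lt_trans v1)// ltry.
suff h : fine (expeR (- u n)) @[n --> \oo] --> (0 : R)%R.
  have h2 : (fine (expeR (- u n)))%:E @[n --> \oo] --> 0.
    by apply: cvg_EFin; [exact: nearW|exact: h].
  by apply: cvg_trans h2; apply: near_eq_cvg; apply: nearW => n; rewrite fineK.
apply/cvgr0Pnorm_le => e e0.
have /cvgeyPge/(_ (- ln e)%R) := uy.
apply: filterS => n un.
rewrite ger0_norm; last by apply: fine_ge0; case/andP: (v01 n).
rewrite -lee_fin fineK// -[X in _ <= X%:E](lnK e0).
rewrite -[leRHS]/(expeR (ln e)%:E) lee_expeR leeNl.
exact: un.
Qed.

Lemma measurable_expeR : measurable_fun setT (@expeR R).
Proof.
rewrite (_ : @expeR R = fun x => if x == -oo then 0 else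
    if x == +oo then +oo else (expR (fine x))%:E); last by apply/funext => -[].
apply: measurable_fun_ifT => //.
  exact: measurable_fun_eqe.
apply: measurable_fun_ifT => //.
  exact: measurable_fun_eqe.
by apply/measurable_EFinP; apply: measurableT_comp => //; exact: measurableT_comp.
Qed.

End exponential.

Section laplace_functional.
Context {R : realType} {d : measure_display} {Om : measurableType d}.
Variables (P : probability Om R) (G : Om -> R -> R)
  (nut : {measure set (R * R) -> \bar R}).
Hypothesis HG : poisson_path P G nut.

Let mu w := stieltjes (G w).

Lemma measurable_integral_path (f : R -> \bar R) : measurable_fun setT f ->
  (forall x, 0 <= f x) -> measurable_fun setT (fun w => \int[mu w]_x f x).
Proof.
move=> mf f0.
apply: (@measurable_fun_integral_kernel _ _ _ (measurableTypeR R) R mu) => //.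
move=> U mU; apply: measurable_stieltjes => //.
- exact: path_nd HG.
- exact: path_rc HG.
- exact: path_measurable HG.
Qed.

Lemma measurable_integral_path_in (A : set R) (f : R -> \bar R) : measurable A ->
  measurable_fun setT f ->
  (forall x, 0 <= f x) -> measurable_fun setT (fun w => \int[mu w]_(x in A) f x).
Proof.
move=> mA mf f0; under eq_fun do rewrite integral_mkcond.
apply: measurable_integral_path.
  by apply/(measurable_restrictT _ _).1 => //; exact: measurable_funTS.
by move=> x; rewrite patchE; case: ifP.
Qed.

(** On ]-oo, M] both the random measure and the exponent of a bounded function
are finite, so that the formula is stable under bounded limits. *)
Definition laplace_on (M : R) (f : R -> R) : Prop :=
  \int[P]_w expeR (- \int[mu w]_(x in `]-oo, M]%classic) (f x)%:E) =
  expeR (- \int[nut]_(p in jumps_in `]-oo, M]%classic)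
             (1 - expR (- (f p.1 * p.2)))%:E).

Lemma laplace_on_step M f : step_fun f -> (forall x, 0 <= f x)%R -> laplace_on M f.
Proof.
move=> [mf _ [s fs]] f0.
pose s' := sort <=%R [seq x <- s | (x < M)%R].
(* The points of s below M in increasing order, followed by M forever:
   the default value M is reached at index size s'. *)
pose t i := nth M s' i.
have ss' : sorted <=%R s' by apply: sort_sorted; exact: le_total.
have tM i : (t i <= M)%R.
  rewrite /t; have [si|si] := leqP (size s') i; first by rewrite nth_default.
  have : nth M s' i \in s' by rewrite mem_nth.
  by rewrite mem_sort mem_filter => /andP[/ltW].
have ndt : nondecreasing_seq t.
  move=> i j ij; rewrite {2}/t; have [sj|sj] := leqP (size s') j.
    by rewrite nth_default// tM.
  by apply: sorted_leq_nth => //; [exact: le_trans|rewrite inE (leq_ltn_trans ij)].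
have tn : t (size s') = M by rewrite /t nth_default.
rewrite /laplace_on -tn; apply: (laplace_step HG) => // i x _ xi.
have xti : (x <= t i)%R.
  by move: xi; case: i => [|i]; rewrite /cell/= in_itv/= => // /andP[].
apply: fs => z zs; apply/idP/idP => [xz|]; last exact: le_trans.
have [Mz|zM] := leP M z; first exact: le_trans (tM i) Mz.
have zs' : z \in s' by rewrite mem_sort mem_filter zM.
have zE : t (index z s') = z by rewrite /t nth_index.
rewrite -zE; case: (leqP i (index z s')) => [|ji]; first exact: ndt.
move: xi; case: i xti ji => [//|i] _ ji; rewrite /cell/= in_itv/= => /andP[tx _].
have : (z < x)%R by apply: le_lt_trans tx; rewrite -zE; exact: ndt.
by rewrite ltNge xz.
Qed.

(** Three applications of dominated convergence: for the random measure with
bound C, for P with bound 1, and for nut with bound 1 - exp (- C v), whose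
integral is finite by hypothesis. *)
Lemma laplace_on_lim M (f_ : nat -> R -> R) f (C : R) :
  (forall n, measurable_fun setT (f_ n)) -> (forall n x, 0 <= f_ n x <= C)%R ->
  (forall x, f_ n x @[n --> \oo] --> f x) ->
  (forall n, laplace_on M (f_ n)) -> laplace_on M f.
Proof.
move=> mf f0C ff IH.
have mI : measurable (`]-oo, M]%classic : set R) by exact: measurable_itv.
have mJ : measurable (jumps_in (`]-oo, M]%classic : set R)).
  exact: measurable_jumps_in.
have C0 : (0 <= C)%R by have /andP[h1 h2] := f0C 0%N 0%R; exact: le_trans h1 h2.
have mef n : measurable_fun setT (EFin \o f_ n) by exact/measurable_EFinP.
have f0 n x : 0 <= (f_ n x)%:E by rewrite lee_fin; case/andP: (f0C n x).
have h1 w : \int[mu w]_(x in `]-oo, M]%classic) (f_ n x)%:E @[n --> \oo] -->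
    \int[mu w]_(x in `]-oo, M]%classic) (f x)%:E.
  apply: (@dominated_cvg _ (measurableTypeR R) R (mu w) _ mI
    (fun n x => (f_ n x)%:E) _ (fun=> C%:E)).
  - by move=> n; apply: measurable_funTS; exact: mef.
  - by move=> x _; apply: cvg_EFin; [exact: nearW|exact: ff].
  - by [].
  - apply/integrableP; split => //.
    rewrite integral_cst// (stieltjes_Nyc HG) ltry//.
  - by move=> n x _; rewrite gee0_abs// lee_fin; case/andP: (f0C n x).
have h2 : \int[P]_w expeR (- \int[mu w]_(x in `]-oo, M]%classic) (f_ n x)%:E) @[n --> \oo] -->
    \int[P]_w expeR (- \int[mu w]_(x in `]-oo, M]%classic) (f x)%:E).
  have i0 n w : 0 <= \int[mu w]_(x in `]-oo, M]%classic) (f_ n x)%:E.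
    by apply: integral_ge0 => x _.
  apply: (@dominated_cvg _ _ R P _ measurableT
    (fun n w => expeR (- \int[mu w]_(x in `]-oo, M]%classic) (f_ n x)%:E)) _ (fun=> 1)).
  - move=> n; apply: measurableT_comp; first exact: measurable_expeR.
    apply: measurableT_comp; first exact: oppe_measurable.
    by apply: measurable_integral_path_in; [exact: mI|exact: mef|exact: f0].
  - move=> w _; apply: (cvg_expeRN (u := fun n => \int[mu w]_(x in _) (f_ n x)%:E)).
      by move=> n; exact: i0.
    exact: h1.
  - by [].
  - exact: finite_measure_integrable_cst.
  - move=> n w _; have /andP[e0 e1] := expeRN_le1 (i0 n w).
    by rewrite gee0_abs.
have h3 : \int[nut]_(p in jumps_in `]-oo, M]%classic) (1 - expR (- (f_ n p.1 * p.2)))%:E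
    @[n --> \oo] --> 
    \int[nut]_(p in jumps_in `]-oo, M]%classic) (1 - expR (- (f p.1 * p.2)))%:E.
  apply: (@dominated_cvg _ _ R nut _ mJ
    (fun n p => (1 - expR (- (f_ n p.1 * p.2)))%:E) _
    (fun p => (1 - expR (- (C * p.2)))%:E)).
  - by move=> n; apply: measurable_funTS; exact: measurable_one_sub_expR.
  - move=> p _; apply: cvg_EFin; first exact: nearW.
    apply: cvgB; first exact: cvg_cst.
    apply: continuous_cvg; first exact: continuous_expR.
    by apply: cvgN; apply: cvgM => //; exact: cvg_cst.
  - by [].
  - apply/integrableP; split.
      by apply: measurable_funTS; exact: (@measurable_one_sub_expR _ (cst C)).
    under eq_integral => p.
      rewrite inE => pJ; rewrite gee0_abs; last exact: (one_sub_expR_ge0 C0 pJ).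
      over.
    exact: path_exponent_fin HG _ _ C0.
  - move=> n [x v] pJ; rewrite gee0_abs; last first.
      by apply: one_sub_expR_ge0 pJ; case/andP: (f0C n x).
    rewrite lee_fin lerB// ler_expR lerN2 ler_wpM2r//.
      by case: pJ => _; rewrite /= in_itv/= andbT => /ltW.
    by case/andP: (f0C n x).
rewrite /laplace_on -(cvg_lim _ h2)//; apply/cvg_lim => //.
under eq_fun do rewrite IH.
apply: (cvg_expeRN (u := fun n =>
  \int[nut]_(p in _) (1 - expR (- (f_ n p.1 * p.2)))%:E)); last exact: h3.
move=> n; apply: integral_ge0 => -[x v] pJ.
by apply: one_sub_expR_ge0 pJ; case/andP: (f0C n x).
Qed.

(** The formula makes sense only for nonnegative functions, whereas step
functions form a vector space; it is therefore proved for the positive part of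
all functions in the class. *)
Lemma laplace_on_bounded M (f : R -> R) (C : R) : measurable_fun setT f ->
  (forall x, 0 <= f x <= C)%R -> laplace_on M f.
Proof.
move=> mf f0C.
suff [_] : measurable_fun setT f /\ laplace_on M (fun x => Num.max 0%R (f x)).
  congr laplace_on; apply/funext => x; rewrite max_r//; by case/andP: (f0C x).
elim: (bounded_limit_measurable mf f0C) => {C f0C mf} {}f.
  move=> sf; split; first by case: sf.
  apply: laplace_on_step => [|x]; last by rewrite le_max lexx.
  have [mf [C fC] [s fs]] := sf; split.
  - exact: measurable_maxr.
  - exists C => x; have C0 := le_trans (normr_ge0 _) (fC x).
    rewrite ger0_norm ?le_max ?lexx// ge_max C0/=.
    exact: le_trans (ler_norm _) (fC x).
  - by exists s => x y /fs ->.
move=> g C _ IH gC; have {}IH n := IH n.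
move: f => f_ in IH gC *.
move=> fg.
have mg : measurable_fun setT g.
  apply: (measurable_fun_cvg (h := f_)) => [n|x _]; last exact: fg.
  by case: (IH n).
split => //.
have C0 : (0 <= C)%R by exact: le_trans (normr_ge0 _) (gC 0%N 0%R).
apply: (laplace_on_lim (f_ := fun n x => Num.max 0%R (f_ n x)) (C := C)).
- by move=> n; apply: measurable_maxr => //; case: (IH n).
- move=> n x; rewrite le_max lexx/= ge_max C0/=.
  exact: le_trans (ler_norm _) (gC n x).
- move=> x; rewrite maxr_absE; under eq_fun do rewrite maxr_absE.
  apply: cvgM; last exact: cvg_cst.
  apply: cvgD; first by apply: cvgD; [exact: cvg_cst|exact: fg].
  by apply: cvg_norm; apply: cvgB; [exact: cvg_cst|exact: fg].
- by move=> n; case: (IH n).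
Qed.

(** Both integrals are increasing limits of those of phi truncated at height n
and restricted to ]-oo, n]. *)
Lemma laplace_functional (phi : R -> \bar R) (l : R) : measurable_fun setT phi ->
  (forall x, 0 <= phi x) -> (0 < l)%R ->
  \int[P]_w expeR (- (l%:E * \int[mu w]_x phi x)) =
  expeR (- laplace_exponent nut phi l).
Proof.
move=> mphi phi0 l0.
have l0' : (0 <= l)%R by exact: ltW.
pose D n := (`]-oo, (n%:R : R)%R]%classic : set R).
have mD n : measurable (D n) by exact: measurable_itv.
have mJD n : measurable (jumps_in (D n)) by exact: measurable_jumps_in.
have DT : \bigcup_n D n = setT.
  apply/seteqP; split => // x _; exists (Num.trunc `|x|%R).+1 => //=.
  by rewrite /D/= in_itv/=; apply: le_trans (ler_norm _) _; apply: ltW; exact: truncnS_gt.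
have ndD m n : (m <= n)%N -> D m `<=` D n.
  move=> mn x; rewrite /D/= !in_itv/= => xm.
  by apply: (le_trans xm); rewrite ler_nat.
(* Truncation at height n; the restriction to D n is the second
   truncation. *)
pose cut n x := fine (Order.min (phi x) (n%:R : R)%R%:E).
have cutE n x : (cut n x)%:E = Order.min (phi x) (n%:R : R)%R%:E.
  rewrite /cut fineK// fin_numE; case: (phi x) (phi0 x) => [r| |]// _.
  by rewrite -EFin_min.
have cut0 n x : (0 <= cut n x)%R.
  by rewrite -lee_fin cutE le_min phi0/= lee_fin.
have cutn n x : (cut n x <= n%:R)%R by rewrite -lee_fin cutE ge_min lexx orbT.
have mcut n : measurable_fun setT (cut n).
  by apply: measurableT_comp => //; exact: measurable_mine.
have ndcut x m n : (m <= n)%N -> (cut m x <= cut n x)%R.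
  move=> mn; rewrite -lee_fin !cutE le_min !ge_min lexx/= lee_fin ler_nat mn.
  by rewrite orbT.
have cutcvg x : (cut n x)%:E @[n --> \oo] --> phi x.
  under eq_fun do rewrite cutE.
  case: (phi x) (phi0 x) => [r| |]// r0.
    apply: cvg_near_cst; exists (Num.trunc r).+1 => // n /= rn.
    rewrite -EFin_min min_l//; apply: ltW; apply: (lt_le_trans (truncnS_gt _)).
    by rewrite ler_nat.
  rewrite (_ : (fun n : nat => _) = (fun n => (n%:R : R)%R%:E)).
    by apply/cvgeryP; exact: cvgr_idn.
  by apply/funext => n; rewrite min_r// leey.
have Dcvg x : \forall n \near \oo, D n x.
  have [m _ Dm] : (\bigcup_n D n) x by rewrite DT.
  by exists m => // n /= mn; exact: ndD Dm.
pose f n x := (l * cut n x)%R.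
have f0 n x : (0 <= f n x)%R by rewrite mulr_ge0.
have mf n : measurable_fun setT (f n) by exact: measurable_funM.
have IH n : laplace_on n%:R%R (f n).
  apply: (@laplace_on_bounded _ _ (l * n%:R)%R) => // x.
  by rewrite f0/= ler_wpM2l.
have h1 w : \int[mu w]_(x in D n) (f n x)%:E @[n --> \oo] -->
    l%:E * \int[mu w]_x phi x.
  rewrite -ge0_integralZl_EFin//.
  under eq_fun do rewrite integral_mkcond.
  apply: (@cvg_ge0_integral _ (measurableTypeR R)).
  - move=> n; apply/(measurable_restrictT _ _).1; first exact: mD.
    by apply/measurable_EFinP; apply: measurable_funTS; exact: mf.
  - by move=> n x; rewrite patchE; case: ifP => // _; rewrite lee_fin.
  - move=> x m n mn; rewrite !patchE.
    case: ifPn => [|_]; last by case: ifP => // _; rewrite lee_fin.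
    by rewrite inE => /(ndD _ _ mn) Dnx; rewrite mem_set// lee_fin ler_wpM2l// ndcut.
  - move=> x; have : l%:E * (cut n x)%:E @[n --> \oo] --> l%:E * phi x by exact: cvgeZl.
    apply: cvg_trans; apply: near_eq_cvg; have := Dcvg x; apply: filterS => n Dn.
    by rewrite patchE mem_set.
have i0 n w : 0 <= \int[mu w]_(x in D n) (f n x)%:E.
  by apply: integral_ge0 => x _; rewrite lee_fin.
have h2 : \int[P]_w expeR (- \int[mu w]_(x in D n) (f n x)%:E) @[n --> \oo] -->
    \int[P]_w expeR (- (l%:E * \int[mu w]_x phi x)).
  apply: (@dominated_cvg _ _ R P _ measurableT
    (fun n w => expeR (- \int[mu w]_(x in D n) (f n x)%:E)) _ (fun=> 1)).
  - move=> n; apply: measurableT_comp; first exact: measurable_expeR.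
    apply: measurableT_comp; first exact: oppe_measurable.
    apply: measurable_integral_path_in; [exact: mD| |by move=> x; rewrite lee_fin].
    by apply/measurable_EFinP; exact: mf.
  - move=> w _.
    apply: (cvg_expeRN (u := fun n => \int[mu w]_(x in D n) (f n x)%:E)); last exact: h1.
    by move=> n; exact: i0.
  - by [].
  - exact: finite_measure_integrable_cst.
  - move=> n w _; have /andP[e0 e1] := expeRN_le1 (i0 n w).
    by rewrite gee0_abs.
have h3 : \int[nut]_(p in jumps_in (D n)) (1 - expR (- (f n p.1 * p.2)))%:E
    @[n --> \oo] --> laplace_exponent nut phi l.
  rewrite /laplace_exponent integral_mkcond.
  under eq_fun do rewrite integral_mkcond.
  apply: cvg_ge0_integral.
  - move=> n; apply/(measurable_restrictT _ _).1 => //.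
    by apply: measurable_funTS; exact: measurable_one_sub_expR.
  - move=> n [x v]; rewrite patchE; case: ifPn => // /[!inE] pJ.
    exact: one_sub_expR_ge0 pJ.
  - move=> [x v] m n mn; rewrite !patchE.
    case: ifPn => [/[!inE] pJ|_]; last first.
      by case: ifPn => // /[!inE] pJ; exact: one_sub_expR_ge0 pJ.
    have pJn : jumps_in (D n) (x, v) by case: pJ => Dm v0; split => //; exact: ndD Dm.
    rewrite mem_set// lee_fin lerB// ler_expR lerN2 ler_wpM2r//.
      by case: pJ => _; rewrite /= in_itv/= andbT => /ltW.
    by rewrite ler_wpM2l// ndcut.
  - move=> [x v]; rewrite !patchE; case: ifPn => [/[!inE] pJ|/negP]; last first.
      rewrite inE => pJ; apply: cvg_near_cst; apply: nearW => n; rewrite patchE memNset//.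
      by move=> [_ v0]; apply: pJ.
    have v0 : (0 < v)%R by case: pJ => _; rewrite /= in_itv/= andbT.
    have h : 1 - expeR (- ((l * v)%:E * (cut n x)%:E)) @[n --> \oo] -->
        1 - expeR (- ((l * v)%:E * phi x)).
      apply: cvgeB; [exact: fin_num_adde_defr|exact: cvg_cst|].
      apply: (cvg_expeRN (u := fun n => (l * v)%:E * (cut n x)%:E)).
        by move=> n; rewrite lee_fin !mulr_ge0// ltW.
      exact: cvgeZl.
    rewrite mulNe; apply: cvg_trans h; apply: near_eq_cvg.
    have := Dcvg x; apply: filterS => n Dn.
    rewrite patchE mem_set; last by split => //; case: pJ.
    by rewrite /= /f mulrAC.
rewrite -(cvg_lim _ h2)//; apply/cvg_lim => //.
under eq_fun do rewrite IH.
apply: (cvg_expeRN (u := fun n =>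
  \int[nut]_(p in jumps_in (D n)) (1 - expR (- (f n p.1 * p.2)))%:E)); last exact: h3.
by move=> n; apply: integral_ge0 => -[x v] pJ; apply: one_sub_expR_ge0 pJ.
Qed.

End laplace_functional.

(** * Almost sure finiteness of an integral *)

Lemma integral_mrestr {d} {T : measurableType d} {R : realType}
    (m : {measure set T -> \bar R}) (D : set T) (mD : measurable D) (f : T -> \bar R) :
  measurable_fun setT f -> (forall x, 0 <= f x) ->
  \int[mrestr m mD]_x f x = \int[m]_(x in D) f x.
Proof.
move=> mf f0.
rewrite (integral_density (mu := m) (nu := mrestr m mD) (rho := \1_D))//.
- rewrite [RHS]integral_mkcond; apply: eq_integral => x _; rewrite patchE indicE.
  by case: ifP => _; rewrite ?mule1 ?mule0.
- by move=> A mA; rewrite /= integral_indic// setIC.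
Qed.

Lemma one_sub_ge0 {R : realType} (x : \bar R) : x <= 1 -> 0 <= 1 - x.
Proof.
case: x => [r| |]//; last by rewrite /= leey.
by rewrite -EFinB !lee_fin subr_ge0.
Qed.

(** exp (- X) is at most 1, and it is 0 where X is infinite. *)
Lemma integral_expeRN_lty {d} {T : measurableType d} {R : realType}
    (P : probability T R) (X : T -> \bar R) : measurable_fun setT X ->
  (forall w, 0 <= X w) ->
  \int[P]_w expeR (- X w) <= P [set w | X w < +oo].
Proof.
move=> mX X0.
have mA : measurable [set w | X w < +oo].
  have := measurable_lte measurableT mX (measurable_cst +oo).
  by rewrite setTI.
rewrite -[X in _ <= P X]setIT -integral_indic//.
apply: ge0_le_integral => //.
- by move=> w _; exact: expeR_ge0.
- apply: measurableT_comp; first exact: measurable_expeR.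
  by apply: measurableT_comp => //; exact: oppe_measurable.
- by apply/measurable_EFinP; exact: measurable_indic.
move=> w _; rewrite indicE; have [Xy|] := ltP (X w) +oo.
  by rewrite mem_set//; case/andP: (expeRN_le1 (X0 w)).
by rewrite leye_eq => /eqP Xy; rewrite memNset/= ?Xy ?ltxx.
Qed.

Section criterion.
Context {R : realType} {d : measure_display} {Om : measurableType d}.
Variables (P : probability Om R) (G : Om -> R -> R)
  (nut : {measure set (R * R) -> \bar R}).
Hypothesis HG : poisson_path P G nut.
Variable phi : R -> \bar R.
Hypotheses (mphi : measurable_fun setT phi) (phi0 : forall x, 0 <= phi x).

Let X w := \int[stieltjes (G w)]_x phi x.

Let mX : measurable_fun setT X.
Proof. exact: measurable_integral_path HG _ _ _. Qed.

Let X0 w : 0 <= X w. Proof. exact: integral_ge0. Qed.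

Let integrand (l : R) (p : R * R) : \bar R := 1 - expeR (- (l * p.2)%:E * phi p.1).

Let mJ : measurable (@positive_jumps R).
Proof. by apply: measurableX => //; exact: measurable_itv. Qed.

Let integrand01 (l : R) p : (0 < l)%R -> positive_jumps p -> 0 <= integrand l p <= 1.
Proof.
move=> l0 [_]; rewrite /= in_itv/= andbT => p0.
have /andP[e0 e1] : 0 <= expeR (- ((l * p.2)%:E * phi p.1)) <= 1.
  by apply: expeRN_le1; rewrite mule_ge0// lee_fin mulr_ge0// ltW.
rewrite /integrand mulNe; apply/andP; split; last first.
  by rewrite -[leRHS]adde0 leeD2l// leeNl oppe0.
exact: one_sub_ge0.
Qed.

Let mintegrand l : measurable_fun setT (integrand l).
Proof.
apply: emeasurable_funB => //.
apply: measurableT_comp; first exact: measurable_expeR.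
apply: emeasurable_funM; last exact: measurableT_comp.
apply: measurableT_comp; first exact: oppe_measurable.
by apply/measurable_EFinP; apply: measurable_funM => //; exact: measurable_snd.
Qed.

(** If the exponent were infinite, exp (- l X) would have expectation 0, so
that X would be infinite almost surely. *)
Lemma ae_lty_laplace_exponent (l : R) : (0 < l)%R -> {ae P, forall w, X w < +oo} ->
  laplace_exponent nut phi l < +oo.
Proof.
move=> l0 aeX; rewrite ltNge leye_eq; apply/negP => /eqP Ly.
have := laplace_functional HG mphi phi0 l0; rewrite Ly /= => I0.
have I0' : \int[P]_w `|expeR (- (l%:E * X w))| = 0.
  by rewrite -[RHS]I0; apply: eq_integral => w _; rewrite gee0_abs// expeR_ge0.
have mE : measurable_fun setT (fun w => expeR (- (l%:E * X w))).
  apply: measurableT_comp; first exact: measurable_expeR.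
  apply: measurableT_comp; first exact: oppe_measurable.
  exact: measurable_funeM.
have /(ae_eq_integral_abs P measurableT mE).1 := I0'.
move=> ae0; have : \forall w \ae P, False.
  have := aeX; apply: filterS2 ae0 => w /(_ Logic.I) /eqP.
  rewrite expeR_eq0 eqe_oppLR/= => /eqP lX Xw.
  have : X w \is a fin_num by rewrite ge0_fin_numE.
  by move=> /fineK Xf; move: lX; rewrite -Xf.
move=> H; have Pgt0 : P [set: Om] > 0 by rewrite probability_setT.
by have [] := @filter_ex _ _ (ae_properfilter_algebraOfSetsType Pgt0) _ H.
Qed.

(** The Laplace functional is applied to the function that is +oo where phi is,
and 0 elsewhere: its random integral is almost surely 0, hence so is its
exponent. *)
Lemma ae_lty_finite_ae : {ae P, forall w, X w < +oo} -> finite_ae nut phi.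
Proof.
move=> aeX.
(* psi + psi = psi, so the integral of psi is 0 as soon as it is
   finite. *)
pose psi x := if phi x == +oo then +oo else 0 : \bar R.
have mpsi : measurable_fun setT psi.
  apply: measurable_fun_ifT => //; exact: measurable_fun_eqe.
have psi0 x : 0 <= psi x by rewrite /psi; case: ifP.
have psile x : psi x <= phi x by rewrite /psi; case: eqP => // ->.
have psi2 x : psi x + psi x = psi x by rewrite /psi; case: ifP => //; rewrite adde0.
have Ipsi w : X w < +oo -> \int[stieltjes (G w)]_x psi x = 0.
  move=> Xw; set I := integral _ _ _.
  have I0 : 0 <= I by exact: integral_ge0.
  have Iy : I < +oo by apply: le_lt_trans Xw; exact: ge0_le_integral.
  have I2 : I + I = I.
    by rewrite /I -ge0_integralD//; apply: eq_integral => x _; exact: psi2.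
  have If : I \is a fin_num by rewrite ge0_fin_numE.
  by have := congr1 (fun y => y - I) I2; rewrite addeK// subee.
have E1 := laplace_functional HG mpsi psi0 ltr01.
have E2 : \int[P]_w expeR (- (1%:E * \int[stieltjes (G w)]_x psi x)) = 1.
  transitivity (\int[P]_w (cst 1) w).
    apply: ge0_ae_eq_integral => //.
    - apply: measurableT_comp; first exact: measurable_expeR.
      apply: measurableT_comp; first exact: oppe_measurable.
      by apply: measurable_funeM; exact: measurable_integral_path HG _ _ _.
    - by move=> w _; exact: expeR_ge0.
    - have := aeX; apply: filterS => w /Ipsi -> _.
      by rewrite mule0 oppe0 expeR0.
  by rewrite integral_cst// mul1e; exact: probability_setT.
have L0 : laplace_exponent nut psi 1 = 0.
  move: E1; rewrite E2 -expeR0 => /expeR_inj /esym /eqP.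
  by rewrite oppe_eq0 => /eqP.
have mi : measurable_fun (@positive_jumps R)
    (fun p : R * R => 1 - expeR (- (1 * p.2)%:E * psi p.1)).
  apply: measurable_funTS; apply: emeasurable_funB => //.
  apply: measurableT_comp; first exact: measurable_expeR.
  apply: emeasurable_funM; last exact: measurableT_comp.
  apply: measurableT_comp; first exact: oppe_measurable.
  by apply/measurable_EFinP; apply: measurable_funM => //; exact: measurable_snd.
have := ae_eq_integral_abs nut mJ mi.
move=> [H _]; have {H} : ae_eq nut (@positive_jumps R)
    (fun p : R * R => 1 - expeR (- (1 * p.2)%:E * psi p.1)) (cst 0).
  apply: H; rewrite -[RHS]L0; apply: eq_integral => p; rewrite inE => pJ.
  rewrite gee0_abs//; have : 0 <= (1 * p.2)%:E * psi p.1.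
    case: pJ => _; rewrite /= in_itv/= andbT => p0.
    by rewrite mule_ge0// lee_fin mul1r ltW.
  by move=> /expeRN_le1/andP[_] h; rewrite mulNe; exact: one_sub_ge0.
apply: filterS => p + pJ; move=> /(_ pJ); rewrite /psi.
case: eqP => [phiy|/eqP phiy _]; last by rewrite ltey.
have p0 : (0 < p.2)%R by case: pJ => _; rewrite /= in_itv/= andbT.
rewrite mulNe gt0_muley ?lte_fin ?mul1r//= sube0 => /eqP.
by rewrite onee_eq0.
Qed.

(** exp (- l X) has expectation at most P (X < +oo). As l tends to 0, the
exponent tends to 0 by dominated convergence, since phi is finite almost
everywhere. *)
Lemma laplace_exponent_ae_lty : finite_ae nut phi ->
  (forall l : R, (0 < l)%R -> laplace_exponent nut phi l < +oo) ->
  {ae P, forall w, X w < +oo}.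
Proof.
move=> fin Lfin.
have Lcvg : laplace_exponent nut phi n.+1%:R^-1 @[n --> \oo] --> 0.
  have [] := @dominated_convergence _ _ R nut _ mJ
    (fun n => integrand n.+1%:R^-1) (cst 0) (integrand 1).
  - by move=> n; exact: measurable_funTS.
  - by [].
  - have := fin; apply: filterS => p phip pJ.
    have /phip phify := pJ.
    have phif : phi p.1 \is a fin_num by rewrite ge0_fin_numE.
    have h : (n.+1%:R^-1 * (p.2 * fine (phi p.1)))%:E @[n --> \oo] --> 0.
      apply: cvg_EFin; first exact: nearW.
      rewrite -[X in _ --> X](mul0r (p.2 * fine (phi p.1))%R).
      by apply: cvgM; [exact: cvg_harmonic|exact: cvg_cst].
    have h2 : 1 - expeR (- (n.+1%:R^-1 * (p.2 * fine (phi p.1)))%:E) @[n --> \oo]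
        --> 1 - expeR (- 0).
      apply: cvgeB; [exact: fin_num_adde_defr|exact: cvg_cst|].
      apply: (cvg_expeRN (u := fun n => (n.+1%:R^-1 * (p.2 * fine (phi p.1)))%:E)) => //.
      move=> n; rewrite lee_fin mulr_ge0// mulr_ge0// ?fine_ge0//.
      by case: pJ => _; rewrite /= in_itv/= andbT => /ltW.
    move: h2; rewrite oppe0 expeR0 subee//; apply: cvg_trans; apply: near_eq_cvg.
    apply: nearW => n; rewrite /integrand mulNe.
    by rewrite -[in RHS](fineK phif) -EFinM mulrA.
  - apply/integrableP; split; first exact: measurable_funTS.
    apply: le_lt_trans (Lfin _ ltr01); rewrite le_eqVlt; apply/orP; left.
    apply/eqP; apply: eq_integral => p; rewrite inE => pJ.
    by rewrite gee0_abs//; case/andP: (integrand01 ltr01 pJ).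
  - apply: aeW => p n pJ.
    have n0 : (0 < n.+1%:R^-1 :> R)%R by rewrite invr_gt0.
    rewrite gee0_abs; last by case/andP: (integrand01 n0 pJ).
    rewrite /integrand leeB// lee_expeR !mulNe leeN2 lee_wpmul2r// lee_fin ler_wpM2r//.
      by case: pJ => _; rewrite /= in_itv/= andbT => /ltW.
    by rewrite invf_le1// ler1n.
  - by move=> _ _; rewrite integral_cst// mul0e.
have mA : measurable [set w | X w < +oo].
  by have := measurable_lte measurableT mX (measurable_cst +oo); rewrite setTI.
have PA n : expeR (- laplace_exponent nut phi n.+1%:R^-1) <= P [set w | X w < +oo].
  have n0 : (0 < n.+1%:R^-1 :> R)%R by rewrite invr_gt0.
  rewrite -(laplace_functional HG mphi phi0 n0).
  apply: (le_trans (integral_expeRN_lty P _ _)).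
  - exact: measurable_funeM.
  - by move=> w; apply: mule_ge0; [rewrite lee_fin ltW|exact: X0].
  apply: le_measure; rewrite ?inE//.
    have := measurable_lte measurableT (measurable_funeM n.+1%:R^-1%:E mX) (measurable_cst +oo).
    by rewrite setTI.
  move=> w; change (n.+1%:R^-1%:E * X w < +oo -> X w < +oo).
  case: (X w) (X0 w) => [r| |]// _; first by rewrite !ltry.
  by rewrite gt0_muley ?lte_fin.
have P1 : P [set w | X w < +oo] = 1.
  apply/eqP; rewrite eq_le probability_le1//=.
  have h : expeR (- laplace_exponent nut phi n.+1%:R^-1) @[n --> \oo] --> 1.
    rewrite -expeR0 -oppe0.
    apply: (cvg_expeRN (u := fun n => laplace_exponent nut phi n.+1%:R^-1)) => // n.
    apply: integral_ge0 => p pJ.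
    have n0 : (0 < n.+1%:R^-1 :> R)%R by rewrite invr_gt0.
    by case/andP: (integrand01 n0 pJ).
  rewrite -(cvg_lim _ h)//; apply: lime_le; first by apply/cvg_ex; exists 1.
  exact: nearW.
exists (~` [set w | X w < +oo]); split => //; first exact: measurableC.
by rewrite probability_setC// P1 subee.
Qed.

End criterion.

(** * Mixing the kernel measures *)

Section mixture_measure.
Context {d d'} {Y : measurableType d} {Z : measurableType d'} {R : realType}.
Variables (mu : {measure set Y -> \bar R}) (kappa : Y -> {measure set Z -> \bar R}).
Hypothesis mkappa : forall A, measurable A -> measurable_fun setT (kappa ^~ A).

(** The hypothesis of measurability is an argument, so that the measure
structure can be attached to this constant. *)
Definition mixture of (forall A, measurable A -> measurable_fun setT (kappa ^~ A)) :=
  fun A : set Z => \int[mu]_y kappa y A.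

Let mix0 : mixture mkappa set0 = 0.
Proof. by rewrite /mixture; apply: integral0_eq => y _; rewrite measure0. Qed.

Let mix_ge0 A : 0 <= mixture mkappa A. Proof. exact: integral_ge0. Qed.

Let mix_sigma : semi_sigma_additive (mixture mkappa).
Proof.
move=> U mU tU mUU; rewrite [X in _ --> X](_ : _ =
  \int[mu]_y (\sum_(n <oo) kappa y (U n))); last first.
  apply: eq_integral => y _.
  by apply/esym/cvg_lim => //; exact/measure_semi_sigma_additive.
apply/cvg_closeP; split.
  by apply: is_cvg_nneseries => n _ _; exact: integral_ge0.
by rewrite closeE// integral_nneseries// => n; exact: mkappa.
Qed.

HB.instance Definition _ := isMeasure.Build _ _ R
  (mixture mkappa) mix0 mix_ge0 mix_sigma.

End mixture_measure.

Section monotone_limits.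
Context {R : realType}.

(** By monotonicity, f (x + h) - f x bounds f y - f x for all y between x and x
+ h. *)
Lemma right_continuous_harmonic (f : R -> R) : nondecreasing f ->
  (forall x, f (x + n.+1%:R^-1)%R @[n --> \oo] --> f x) -> right_continuous f.
Proof.
move=> ndf fx x; apply/cvgrPdist_le => e e0.
have /cvgrPdist_le/(_ _ e0)[n _ /(_ n (leqnn n))] := fx x.
set h := (n.+1%:R^-1)%R => fh.
have h0 : (0 < h)%R by rewrite invr_gt0.
near=> y.
have xy : (x <= y)%R by apply: ltW; near: y; exact: nbhs_right_gt.
have yh : (y <= x + h)%R by near: y; apply: nbhs_right_le; rewrite ltrDl.
have fxh : (0 <= f (x + h) - f x)%R.
  by rewrite subr_ge0; apply: ndf; rewrite lerDl ltW.
have fxy : (0 <= f y - f x)%R by rewrite subr_ge0; exact: ndf.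
move: fh; rewrite distrC (ger0_norm fxh) => fh.
rewrite distrC (ger0_norm fxy); apply: le_trans fh.
by rewrite lerD2r; exact: ndf.
Unshelve. all: by end_near. Qed.

Lemma cvg_nat_lim_pinfty (f : R -> \bar R) : nondecreasing f ->
  f (n%:R : R)%R @[n --> \oo] --> lim (f t @[t --> +oo%R]).
Proof.
move=> ndf; have h := nondecreasing_cvge (f := f) ndf.
rewrite (cvg_lim _ h)//; apply: cvg_comp h; exact: cvgr_idn.
Qed.

Lemma le_lim_pinfty (f : R -> \bar R) t : nondecreasing f ->
  f t <= lim (f t @[t --> +oo%R]).
Proof.
move=> ndf; have h := nondecreasing_cvge (f := f) ndf.
by rewrite (cvg_lim _ h)//; apply: ereal_sup_ubound; exists t.
Qed.

End monotone_limits.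

Section kernel_mixture.
Context {R : realType}.
Variables (k : R -> R -> R).
Hypotheses (k0 : forall t x, (0 <= k t x)%R) (mk : forall t, measurable_fun setT (k t))
  (ndk : forall x, nondecreasing (k ^~ x)) (rck : forall x, right_continuous (k ^~ x)).

Lemma cvg_kbar x : (k n%:R%R x)%:E @[n --> \oo] --> kbar k x.
Proof.
apply: (cvg_nat_lim_pinfty (f := fun t => (k t x)%:E)) => s t st.
by rewrite lee_fin; exact: ndk.
Qed.

Lemma kbar_ge0 x : 0 <= kbar k x.
Proof. by have := @cvg_kbar x; apply: cvg_ge0 => n; rewrite lee_fin. Qed.

Lemma measurable_kbar : measurable_fun setT (kbar k).
Proof.
apply: (emeasurable_fun_cvg (fun n x => (k n%:R%R x)%:E)) => [n|x _].
  exact/measurable_EFinP.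
exact: cvg_kbar.
Qed.

Lemma measurable_kernel_measure (A : set R) : measurable A ->
  measurable_fun setT (fun x => stieltjes (k ^~ x) A).
Proof. by move=> mA; apply: measurable_stieltjes. Qed.

Variable mu : {measure set (measurableTypeR R) -> \bar R}.
Let Z t := \int[mu]_x (k t x)%:E.
Let Zb := lim (Z t @[t --> +oo%R]).

Let ndZ : nondecreasing Z.
Proof.
move=> s t st; apply: ge0_le_integral => //.
- by move=> x _; rewrite lee_fin.
- by apply/measurable_EFinP; exact: mk.
- by apply/measurable_EFinP; exact: mk.
- by move=> x _; rewrite lee_fin; exact: ndk.
Qed.

Lemma lim_integral_kernel : Zb = \int[mu]_x kbar k x.
Proof.
rewrite /Zb -(cvg_lim _ (cvg_nat_lim_pinfty ndZ))//; apply/cvg_lim => //.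
apply: (@cvg_ge0_integral _ (measurableTypeR R)).
- by move=> n; apply/measurable_EFinP; exact: mk.
- by move=> n x; rewrite lee_fin.
- by move=> x m n mn; rewrite lee_fin; apply: ndk; rewrite ler_nat.
- exact: cvg_kbar.
Qed.

Hypothesis Zby : Zb < +oo.

Let Z0 t : 0 <= Z t. Proof. by apply: integral_ge0 => x _; rewrite lee_fin. Qed.

Let Zfin t : Z t \is a fin_num.
Proof. by rewrite ge0_fin_numE//; apply: le_lt_trans Zby; exact: le_lim_pinfty. Qed.

Let Phi t := fine (Z t).

Let ik t : mu.-integrable setT (fun x => (k t x)%:E).
Proof.
apply/integrableP; split; first by apply/measurable_EFinP; exact: mk.
under eq_integral do rewrite gee0_abs ?lee_fin//.
by rewrite -/(Z t) -ge0_fin_numE.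
Qed.

Let ndPhi : nondecreasing Phi.
Proof. by move=> s t st; apply: fine_le => //; exact: ndZ. Qed.

Let rcPhi : right_continuous Phi.
Proof.
apply: right_continuous_harmonic ndPhi _ => t.
have h : Z (t + n.+1%:R^-1)%R @[n --> \oo] --> Z t.
  apply: (@dominated_cvg _ (measurableTypeR R) R mu _ measurableT
    (fun n x => (k (t + n.+1%:R^-1) x)%:E) _ (fun x => (k (t + 1) x)%:E)) => //.
  - by move=> n; apply/measurable_EFinP; exact: mk.
  - move=> x _; apply: cvg_EFin; first exact: nearW.
    have /cvg_at_rightP := @rck x t; apply; split.
      by move=> n; rewrite ltrDl invr_gt0.
    rewrite -[X in _ --> X]addr0; apply: cvgD; first exact: cvg_cst.
    exact: cvg_harmonic.
  - move=> n x _; rewrite gee0_abs ?lee_fin//; apply: ndk.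
    by rewrite lerD2l invf_le1// ler1n.
by have /fine_cvgP[] : Z (t + n.+1%:R^-1)%R @[n --> \oo] --> (Phi t)%:E by rewrite fineK.
Qed.

Let kappa (x : measurableTypeR R) :
  {measure set (measurableTypeR R) -> \bar R} := stieltjes (k ^~ x).

Let mkappa (A : set (measurableTypeR R)) : measurable A ->
  measurable_fun setT (kappa ^~ A).
Proof. exact: measurable_kernel_measure. Qed.

(** Phi has the mixture of the increments of k(., x) as its increments. *)
Lemma stieltjes_mixture A : measurable A ->
  stieltjes Phi A = \int[mu]_x stieltjes (k ^~ x) A.
Proof.
move=> mA.
pose M : {measure set (measurableTypeR R) -> \bar R} :=
  mixture mu mkappa.
suff H a b : (a < b)%R -> M `]a, b]%classic = (Phi b - Phi a)%:E.
  exact: (@stieltjes_unique R Phi M ndPhi rcPhi H A mA).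
move=> ab; rewrite -[LHS]/(\int[mu]_x stieltjes (k ^~ x) `]a, b]%classic).
under eq_integral do rewrite (stieltjes_itv_oc (@ndk _) (@rck _) (ltW ab)).
under eq_integral do rewrite EFinB.
by rewrite integralB// EFinB !fineK.
Qed.

Lemma integral_stieltjes_kernel (h : R -> \bar R) : measurable_fun setT h ->
  (forall t, 0 <= h t) ->
  \int[stieltjes Phi]_t h t = \int[mu]_x \int[stieltjes (k ^~ x)]_t h t.
Proof.
apply: (@integral_mixture _ _ _ (measurableTypeR R)).
- exact: mkappa.
- exact: stieltjes_mixture.
Qed.

(** The normalized function is Phi divided by the constant Zb. If Zb is 0, then
Phi vanishes and both functions are identically 0. *)
Lemma integral_normalized_lty (h : R -> \bar R) : measurable_fun setT h ->
  (forall t, 0 <= h t) ->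
  \int[stieltjes (fun t => fine (Z t / Zb))]_t h t < +oo <->
  \int[mu]_x \int[stieltjes (k ^~ x)]_t h t < +oo.
Proof.
move=> mh h0; have <- := integral_stieltjes_kernel mh h0.
have Zb0 : 0 <= Zb by apply: (le_trans (Z0 0%R)); exact: le_lim_pinfty.
have Zbfin : Zb \is a fin_num by rewrite ge0_fin_numE.
pose z := fine Zb.
have z0 : (0 <= z)%R by exact: fine_ge0.
(* The case Zb = 0, where the quotients are 0 / 0 = 0. *)
have [zE|zN0] := eqVneq z 0%R.
  have ZbE : Zb = 0 by rewrite -(fineK Zbfin) -/z zE.
  suff -> : (fun t => fine (Z t / Zb)) = Phi by [].
  apply/funext => t; rewrite /Phi; have -> : Z t = 0.
    by apply/eqP; rewrite eq_le Z0 andbT -ZbE; exact: le_lim_pinfty.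
  by rewrite mul0e.
have zgt : (0 < z)%R by rewrite lt_neqAle eq_sym zN0.
have FE : (fun t => fine (Z t / Zb)) = (fun t => z^-1 * Phi t)%R.
  apply/funext => t; rewrite -(fineK (Zfin t)) -(fineK Zbfin) -/z -/(Phi t).
  by rewrite inver (negbTE zN0) -EFinM/= mulrC.
rewrite FE.
have c0 : (0 <= z^-1)%R by rewrite invr_ge0.
have sE A : measurable A ->
    stieltjes (fun t => z^-1 * Phi t)%R A = mscale (NngNum c0) (stieltjes Phi) A.
  apply: (stieltjes_unique (m := mscale (NngNum c0) (stieltjes Phi))).
  - by move=> s t st; rewrite ler_wpM2l//; exact: ndPhi.
  - by move=> t; apply: cvgM; [exact: cvg_cst|exact: rcPhi].
  - move=> a b ab; rewrite -[LHS]/(z^-1%:E * stieltjes Phi `]a, b]%classic).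
    rewrite (stieltjes_itv_oc ndPhi rcPhi (ltW ab)).
    by rewrite -EFinM mulrBr.
rewrite (eq_measure_integral (mscale (NngNum c0) (stieltjes Phi))); last first.
  by move=> A mA _; exact: sE.
rewrite ge0_integral_mscale//=.
have I0 : 0 <= \int[stieltjes Phi]_t h t by exact: integral_ge0.
split=> [|I]; last by apply: lte_mul_pinfty => //; rewrite lee_fin.
case: (integral _ _ _) I0 => [r| |]// _; first by rewrite !ltry.
by rewrite gt0_muley ?lte_fin ?invr_gt0.
Qed.

End kernel_mixture.

(** * Regular paths of the driving process *)

Section distribution_function_facts.
Context {R : realType}.
Variable alpha : {measure set R -> \bar R}.
Hypothesis alpha_fin : alpha setT < +oo.
Let A := distribution_function alpha.

Let fin (B : set R) : measurable B -> alpha B \is a fin_num.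
Proof.
move=> mB; rewrite ge0_fin_numE//; apply: le_lt_trans alpha_fin.
by apply: le_measure; rewrite ?inE.
Qed.

Lemma distribution_function_ge0 x : (0 <= A x)%R.
Proof. exact: fine_ge0. Qed.

Lemma distribution_function_nd : nondecreasing A.
Proof.
have finx x : alpha `]-oo, x]%classic \is a fin_num by apply: fin; exact: measurable_itv.
move=> x y xy; apply: fine_le; [exact: finx|exact: finx|].
apply: le_measure; rewrite ?inE; [exact: measurable_itv|exact: measurable_itv|].
by move=> z /=; rewrite !in_itv/= => zx; exact: le_trans xy.
Qed.

Lemma distribution_function_rc : right_continuous A.
Proof.
apply: right_continuous_harmonic distribution_function_nd _ => x.
have h : alpha `]-oo, (x + n.+1%:R^-1)%R]%classic @[n --> \oo] --> alpha `]-oo, x]%classic.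
  have E : `]-oo, x]%classic = \bigcap_n `]-oo, (x + n.+1%:R^-1)%R]%classic.
    apply/seteqP; split => [y /= yx n _|y yn] /=; rewrite in_itv/=.
      by move: yx; rewrite in_itv/= => yx; apply: (le_trans yx); rewrite lerDl invr_ge0.
    apply/ler_addgt0Pr => e e0.
    have [n ne] : exists n : nat, (n.+1%:R^-1 < e)%R.
      by exists (Num.trunc e^-1); rewrite invf_plt ?posrE//; exact: truncnS_gt.
    have := yn n Logic.I; rewrite /= in_itv/= => /le_trans; apply.
    by rewrite lerD2l ltW.
  rewrite E; apply: nonincreasing_cvg_mu.
  - by apply: le_lt_trans alpha_fin; apply: le_measure; rewrite ?inE//.
  - by move=> n; exact: measurable_itv.
  - by rewrite -E; exact: measurable_itv.
  - move=> m n mn; apply/subsetPset => y /=; rewrite !in_itv/= => /le_trans; apply.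
    by rewrite lerD2l lef_pV2 ?posrE// ler_nat.
have {}h : alpha `]-oo, (x + n.+1%:R^-1)%R]%classic @[n --> \oo] --> (A x)%:E.
  by rewrite fineK//; apply: fin; exact: measurable_itv.
by have /fine_cvgP[] := h.
Qed.

Lemma distribution_function_cvgNy (e : R) : (0 < e)%R ->
  \forall x \near -oo%R, (A x < e)%R.
Proof.
move=> e0.
have h : alpha `]-oo, (- (n%:R : R))%R]%classic @[n --> \oo] --> alpha set0.
  have E : set0 = \bigcap_n `]-oo, (- (n%:R : R))%R]%classic.
    apply/seteqP; split => // y yn.
    have := yn (Num.trunc `|y|%R).+1 Logic.I; rewrite /= in_itv/= lerNr.
    by rewrite leNgt (le_lt_trans (ler_norm _))// normrN truncnS_gt.
  rewrite E; apply: nonincreasing_cvg_mu.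
  - by apply: le_lt_trans alpha_fin; apply: le_measure; rewrite ?inE//.
  - by move=> n; exact: measurable_itv.
  - by rewrite -E.
  - move=> m n mn; apply/subsetPset => y /=; rewrite !in_itv/= => /le_trans; apply.
    by rewrite lerN2 ler_nat.
move: h; rewrite measure0 => /fine_cvgP[_ /cvgrPdist_lt/(_ _ e0)[n _ /(_ n (leqnn n))]].
rewrite /= sub0r normrN => An.
near=> x; apply: (le_lt_trans (distribution_function_nd (_ : x <= - n%:R)%R)).
  by near: x; apply: nbhs_ninfty_le; rewrite num_real.
exact: le_lt_trans (ler_norm _) An.
Unshelve. all: by end_near. Qed.

End distribution_function_facts.

Section regular_path.
Context {R : realType} {d : measure_display} {Om : measurableType d}.
Variables (P : probability Om R) (L : R -> Om -> R)
  (alpha : {measure set R -> \bar R}) (nu : R -> {measure set R -> \bar R})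
  (nut : {measure set (R * R) -> \bar R}) (k : R -> R -> R).
Hypothesis HF : normalized_IAP P L alpha nu nut k.
Let A := distribution_function alpha.

Let alpha_fin : alpha setT < +oo. Proof. by case/andP: (alpha_mass HF). Qed.

Definition regular_path_at (w : Om) : Prop :=
  [/\ L 0%R w = 0%R, (forall y z : R, (0 <= y)%R -> (y <= z)%R -> (L y w <= L z w)%R) &
    forall y : R, (0 <= y)%R -> L z w @[z --> y^'+] --> L y w].

Lemma ae_regular_path : exists N, [/\ measurable N, P N = 0 &
  forall w, ~ N w -> regular_path_at w].
Proof.
have iap := driving_iap HF.
have [N [mN N0 gN]] : {ae P, forall w, regular_path_at w}.
  by apply: filterS3 (iap_start iap) (iap_nondecreasing iap) (iap_right_continuous iap).
exists N; split => // w Nw; apply: contrapT => nw; apply: Nw; exact: gN.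
Qed.

Variable N : set Om.
Hypotheses (mN : measurable N) (N0 : P N = 0)
  (NP : forall w, ~ N w -> regular_path_at w).

(** The value 0 on the null set N makes the path regular for every w. *)
Definition regular_path (w : Om) (x : R) : R :=
  if w \in N then 0%R else reparameterized L alpha x w.
Let G := regular_path.

Lemma regular_path_out w : ~ N w -> G w = reparameterized L alpha ^~ w.
Proof. by move=> Nw; apply/funext => x; rewrite /G /regular_path memNset. Qed.

Let regular_path_in w : N w -> G w = cst 0%R.
Proof. by move=> Nw; apply/funext => x; rewrite /G /regular_path mem_set. Qed.

Let A0 := distribution_function_ge0 alpha.
Let ndA := distribution_function_nd alpha_fin.

Lemma regular_path_nd w : nondecreasing (G w).
Proof.
move=> x y xy; have [/regular_path_in ->//|Nw] := pselect (N w).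
rewrite regular_path_out//; have [_ ndL _] := NP Nw.
by apply: ndL; [exact: A0|exact: ndA].
Qed.

(** A may be constant to the right of x; the limit of L at A x from the right
is only needed at points where A y exceeds A x. *)
Lemma regular_path_rc w : right_continuous (G w).
Proof.
have [/regular_path_in -> x|Nw] := pselect (N w); first exact: cvg_cst.
rewrite regular_path_out// => x; have [_ _ rcL] := NP Nw.
apply/cvgrPdist_le => e e0.
have /cvgrPdist_le/(_ _ e0) [r /= r0 Lr] := rcL _ (A0 x).
have /cvgrPdist_lt/(_ _ r0) := distribution_function_rc alpha_fin (x := x).
rewrite -/A => Ar; near=> y; rewrite /reparameterized -/A.
have xy : (x < y)%R by near: y; exact: nbhs_right_gt.
have : (A x <= A y)%R by apply: ndA; exact: ltW.
rewrite le_eqVlt => /predU1P[->|Axy]; first by rewrite subrr normr0 ltW.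
by apply: Lr => //=; near: y.
Unshelve. all: by end_near. Qed.

Lemma regular_path_cvg0 w : G w x @[x --> -oo%R] --> (0 : R)%R.
Proof.
have [/regular_path_in ->|Nw] := pselect (N w); first exact: cvg_cst.
rewrite regular_path_out//; have [L0 _ rcL] := NP Nw.
apply/cvgrPdist_le => e e0.
have /cvgrPdist_le/(_ _ e0) [r /= r0 Lr] := rcL _ (lexx 0%R).
have Ar := distribution_function_cvgNy alpha_fin r0.
near=> y; rewrite /reparameterized -/A -[X in (`|X - _|)%R]L0.
have := A0 y; rewrite -/A le_eqVlt => /predU1P[<-|Ay]; first by rewrite subrr normr0 ltW.
apply: Lr => //=; rewrite sub0r normrN gtr0_norm//; near: y; exact: Ar.
Unshelve. all: by end_near. Qed.

Let mLA x : measurable_fun setT (L (A x)).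
Proof. by apply: (iap_measurable (driving_iap HF)); exact: A0. Qed.

Lemma measurable_regular_path x : measurable_fun setT (G ^~ x).
Proof.
apply: measurable_fun_ifT => //; last exact: mLA.
by apply: (measurable_fun_bool true); rewrite setTI preimage_mem_true.
Qed.

Let eq_out (B C : set Om) : measurable B -> measurable C ->
  (forall w, ~ N w -> B w <-> C w) -> P B = P C.
Proof.
move=> mB mC BC.
have h (D : set Om) : measurable D -> P D = P (D `\` N).
  move=> mD; rewrite (measureDI P mD mN) [X in _ + X](_ : _ = 0) ?adde0//.
  by apply: (@subset_measure0 _ _ _ P _ N) => //; exact: measurableI.
rewrite h// (h C)//; congr (P _).
by apply/seteqP; split => w [Dw Nw]; split => //; apply/BC.
Qed.

Lemma regular_path_independent n t : nondecreasing_seq t ->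
  mutually_independent P (fun i : 'I_n => increment G t i).
Proof.
move=> ndt B mB.
(* The clock of the increments, shifted by one because the first
   increment starts at time 0. *)
pose u (i : nat) : R := if i is j.+1 then A (t j) else 0%R.
have ndu : nondecreasing_seq u.
  apply/nondecreasing_seqP => -[|i]; first exact: A0.
  by apply: ndA; exact: ndt.
have := iap_independent_increments (driving_iap HF) (n := n) (lexx 0%R) ndu mB.
have u0 i : (0 <= u i)%R by case: i => // i; exact: A0.
have mL i : measurable_fun setT (fun w => L (u i.+1) w - L (u i) w)%R.
  by apply: measurable_funB; apply: (iap_measurable (driving_iap HF)).
have mG i : measurable_fun setT (increment G t i).
  apply: measurable_funB; first exact: measurable_regular_path.
  by case: i => // i; exact: measurable_regular_path.
have E (i : nat) w : ~ N w -> (L (u i.+1) w - L (u i) w = increment G t i w)%R.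
  move=> Nw; rewrite /increment regular_path_out//; case: i => [|i]//.
  by have [-> _ _] := NP Nw.
have mpre (f : Om -> R) (C : set R) : measurable_fun setT f -> measurable C ->
    measurable (f @^-1` C).
  by move=> mf mC; rewrite -[X in measurable X]setTI; exact: mf.
pose X (i : 'I_n) w := (L (u i.+1) w - L (u i) w)%R.
move=> H; rewrite (eq_out (C := \bigcap_(i : 'I_n) (X i @^-1` B i))).
- rewrite H; apply: eq_bigr => i _; apply: eq_out.
  + by apply: mpre.
  + by apply: mpre.
  + by move=> w Nw /=; rewrite E.
- by apply: fin_bigcap_measurable => // i _; apply: mpre => //; exact: mG.
- by apply: fin_bigcap_measurable => // i _; apply: mpre => //; exact: mL.
- by move=> w Nw; split => h i _ /=; have := h i I; rewrite /X/= E.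
Qed.

(** On ]0, +oo[, the measure nu x is the image under the second coordinate of
nut restricted to the jumps up to x. *)
Lemma nut_exponent x (c : R) : (0 <= c)%R ->
  \int[nut]_(p in jumps_in `]-oo, x]%classic) (1 - expR (- (c * p.2)))%:E =
  \int[nu x]_(v in `]0%R, +oo[) (1 - expR (- c * v))%:E.
Proof.
move=> c0.
(* The maximum only serves to have a nonnegative function on the whole
   line. *)
pose h (v : R) := (1 - expR (- (c * Num.max 0 v)))%R%:E.
have mh : measurable_fun setT h.
  apply/measurable_EFinP; apply: measurable_funB => //.
  apply: measurableT_comp => //; apply: measurableT_comp => //.
  by apply: measurable_funM => //; exact: measurable_maxr.
have h0 v : 0 <= h v.
  by rewrite lee_fin subr_ge0 -expR0 ler_expR oppr_le0 mulr_ge0// le_max lexx.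
have mI : measurable (`]0%R, +oo[%classic : set R) by exact: measurable_itv.
have mJ : measurable (jumps_in (`]-oo, x]%classic : set R)).
  by apply: measurable_jumps_in; exact: measurable_itv.
transitivity (\int[nut]_(p in jumps_in `]-oo, x]%classic) (h \o snd) p).
  apply: eq_integral => -[y v]; rewrite inE => -[_].
  by rewrite /= in_itv/= andbT /h => v0; rewrite max_r// ltW.
have msnd : measurable_fun setT (@snd R R) by exact: measurable_snd.
have mhs : measurable_fun setT (h \o @snd R R) by exact: measurableT_comp.
rewrite -(integral_mrestr nut mJ mhs); last by move=> p; exact: h0.
transitivity (\int[pushforward (mrestr nut mJ) (@snd R R)]_v h v).
  by rewrite (ge0_integral_pushforward msnd)// preimage_setT.
rewrite (eq_measure_integral (mrestr (nu x) mI)); last first.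
  move=> B mB _; rewrite /pushforward/= /mrestr -(nut_intensity HF); last 2 first.
  - exact: measurableI.
  - exact: subIsetr.
  congr (nut _); apply/seteqP; split => -[y v] /=.
    by move=> [Bv [/= yx v0]]; split.
  by move=> [/= yx [Bv v0]]; split.
rewrite (integral_mrestr (nu x) mI mh h0).
apply: eq_integral => v; rewrite inE/= in_itv/= andbT.
by move=> v0; rewrite /h max_r ?mulNr// ltW.
Qed.

(** Finiteness of the exponents comes from the Levy condition, since 1 -
exp(-cv) is at most max(1, c) min(1, v). *)
Lemma regular_path_poisson : poisson_path P G nut.
Proof.
split.
- exact: regular_path_nd.
- exact: regular_path_rc.
- exact: regular_path_cvg0.
- exact: measurable_regular_path.
- exact: regular_path_independent.
- move=> x c c0; rewrite nut_exponent//.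
  apply: (@le_lt_trans _ _
      (\int[nu x]_(v in `]0%R, +oo[) ((Num.max 1 c)%:E * (Num.min 1 v)%:E))).
    apply: ge0_le_integral.
    + exact: measurable_itv.
    + move=> v; rewrite /= in_itv/= andbT => v0.
      by rewrite lee_fin subr_ge0 -expR0 ler_expR mulNr oppr_le0 mulr_ge0// ltW.
    + apply: measurable_funTS; apply/measurable_EFinP; apply: measurable_funB => //.
      by apply: measurableT_comp => //; exact: measurable_funM.
    + apply: measurable_funTS; apply: measurable_funeM; apply/measurable_EFinP.
      exact: measurable_minr.
    + move=> v; rewrite /= in_itv/= andbT => v0.
      rewrite -EFinM lee_fin; have [v1|v1] := leP v 1%R.
        apply: (@le_trans _ _ (c * v)%R).
          by rewrite lerBlDl -lerBlDr -mulNr expR_ge1Dx.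
        by rewrite ler_wpM2r ?le_max ?lexx ?orbT// ltW.
      rewrite mulr1; apply: (@le_trans _ _ 1%R); last by rewrite le_max lexx.
      by rewrite gerBl expR_ge0.
  rewrite ge0_integralZl_EFin.
  + by apply: lte_mul_pinfty; rewrite ?lee_fin ?le_max ?ler01//; exact: nu_levy HF x.
  + exact: measurable_itv.
  + move=> v; rewrite /= in_itv/= andbT => v0.
    by rewrite lee_fin le_min ler01 ltW.
  + by apply: measurable_funTS; apply/measurable_EFinP; exact: measurable_minr.
  + by rewrite le_max ler01.
- move=> x c c0; rewrite nut_exponent//.
  rewrite -(laplace_transform HF x c0) unlock; apply: ge0_ae_eq_integral => //.
  + apply/measurable_EFinP; apply: measurableT_comp => //; apply: measurableT_comp => //.
    by apply: measurable_funM => //; exact: measurable_regular_path.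
  + apply/measurable_EFinP; apply: measurableT_comp => //.
    by apply: measurable_funM => //; exact: mLA.
  + have aeN : {ae P, forall w, ~ N w}.
      by exists N; split => // w /= /contrapT.
    by apply: filterS aeN => w Nw _; rewrite (regular_path_out Nw) mulNr.
Qed.

End regular_path.

Theorem proposition1 (R : realType) (d : measure_display)
    (Om : measurableType d) (P : probability Om R)
    (L : R -> Om -> R) (alpha : {measure set R -> \bar R})
    (nu : R -> {measure set R -> \bar R})
    (nut : {measure set (R * R) -> \bar R}) (k : R -> R -> R)
    (HF : normalized_IAP P L alpha nu nut k)
    (g : R -> R) (mg : measurable_fun setT g) :
  {ae P, forall w,
    \int[stieltjes (normalized_df L alpha k ^~ w)]_t `|g t|%:E < +oo}
  <->
  finite_ae nut (htilde g k) /\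
  forall l : R, (0 < l)%R -> laplace_exponent nut (htilde g k) l < +oo.
Proof.
have [N [mN N0 NP]] := ae_regular_path HF.
have pG := regular_path_poisson HF mN N0 NP.
have k0 := kernel_ge0 HF.
have mk := kernel_measurable HF.
have ndk := kernel_nondecreasing HF.
have rck := kernel_right_continuous HF.
pose G := regular_path L alpha N.
pose mu w := stieltjes (G w).
have mabs : measurable_fun setT (fun t => `|g t|%R) by exact: measurableT_comp.
have mg' : measurable_fun setT (fun t => `|g t|%:E) by exact/measurable_EFinP.
have g0 t : 0 <= `|g t|%:E by rewrite lee_fin.
have hE x : htilde g k x = \int[stieltjes (k ^~ x)]_t `|g t|%:E.
  rewrite /htilde; apply: integral_stieltjes_derive1 => //.
  exact: kernel_absolutely_continuous HF x.
have h0 x : 0 <= htilde g k x by rewrite hE; exact: integral_ge0.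
have mh : measurable_fun setT (htilde g k).
  rewrite (_ : htilde g k = fun x => \int[stieltjes (k ^~ x)]_t `|g t|%:E); last first.
    exact/funext.
  apply: (@measurable_fun_integral_kernel _ _ _ (measurableTypeR R) R
    (fun x => stieltjes (k ^~ x))) => // B mB.
  exact: measurable_kernel_measure.
have kbar_lty : {ae P, forall w, \int[mu w]_x kbar k x < +oo}.
  apply: (laplace_exponent_ae_lty pG).
  - exact: measurable_kbar.
  - exact: kbar_ge0.
  - exact: kbar_finite HF.
  - exact: kbar_exponent HF.
have NN : {ae P, forall w, ~ N w} by exists N; split => // w /= /contrapT.
have key w : ~ N w -> \int[mu w]_x kbar k x < +oo ->
    (\int[stieltjes (normalized_df L alpha k ^~ w)]_t `|g t|%:E < +oo <->
     \int[mu w]_x htilde g k x < +oo).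
  move=> Nw; have muE : mu w = stieltjes (reparameterized L alpha ^~ w).
    by rewrite /mu /G (regular_path_out _ _ Nw).
  rewrite -(lim_integral_kernel k0 mk ndk (mu w)) => Zy.
  have := integral_normalized_lty k0 mk ndk rck Zy mg' g0.
  have -> : \int[mu w]_x htilde g k x = \int[mu w]_x \int[stieltjes (k ^~ x)]_t `|g t|%:E.
    by apply: eq_integral => x _; exact: hE.
  rewrite /normalized_df /Zbar /Zproc -muE.
  exact.
suff -> : {ae P, forall w,
    \int[stieltjes (normalized_df L alpha k ^~ w)]_t `|g t|%:E < +oo} <->
    {ae P, forall w, \int[mu w]_x htilde g k x < +oo}.
  split=> [H|[Hf HL]]; last exact: (laplace_exponent_ae_lty pG).
  split; first exact: (ae_lty_finite_ae pG).
  by move=> l l0; exact: (ae_lty_laplace_exponent pG).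
split => H.
- by apply: filterS3 NN kbar_lty H => w Nw Zw; exact: (key w Nw Zw).1.
- by apply: filterS3 NN kbar_lty H => w Nw Zw; exact: (key w Nw Zw).2.
Qed.
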